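(* Let $0<\beta<1$ and let $\mu,\nu$ be real. The following inequalities hold for all $x>0$. (1) If $\mu>-1$ and $-\mu-1<\nu\leq0$, then $$\int_0^x \mathrm{e}^{-\beta u}u^{\nu}\tilde{t}_{\mu,\nu}(u)\,\mathrm{d}u>\frac{1}{1-\beta}\big\{\mathrm{e}^{-\beta x}x^\nu\tilde{t}_{\mu,\nu}(x)-B_{\mu,\nu,\beta}(x)\big\}.$$ (2) If $\mu>\frac{1}{2}$ and $\frac{3}{2}\leq\nu<\mu+1$, then $$\int_0^x \mathrm{e}^{-\beta u}u^{\nu}\tilde{t}_{\mu,\nu}(u)\,\mathrm{d}u>\frac{1}{1-\beta}\bigg\{\bigg(1-\frac{4\nu^2}{(2\nu-1)(1-\beta)}\frac{1}{x}\bigg)\mathrm{e}^{-\beta x}x^\nu \tilde{t}_{\mu,\nu}(x)-B_{\mu,\nu,\beta}(x)\bigg\}.$$ (3) If $\mu>-\frac{1}{2}$ and $\frac{1}{2}<\nu<\mu+1$, then $$\int_0^x\mathrm{e}^{-\beta u}u^\nu \tilde{t}_{\mu,\nu}(u)\,\mathrm{d}u>\frac{1}{1-\beta}\bigg\{\bigg(1-\frac{2\nu(\mu+\nu+\frac{1}{2}(5+\sqrt{17}))}{(2\nu-1)(1-\beta)}\frac{1}{x}\bigg)\mathrm{e}^{-\beta x}x^\nu \tilde{t}_{\mu,\nu}(x)-B_{\mu,\nu,\beta}(x)\bigg\}.$$ (4) If $\mu>-\frac{5}{2}$ and $-\mu-2<\nu\leq\mu+3$, then $$\int_0^x \mathrm{e}^{-\beta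 u}u^{\nu}\tilde{t}_{\mu,\nu}(u)\,\mathrm{d}u>\mathrm{e}^{-\beta x}x^\nu\sum_{k=0}^\infty \beta^k \tilde{t}_{\mu+k+1,\nu+k+1}(x).$$ Moreover, each of the inequalities (1)--(4) is tight in the limit $x\rightarrow\infty$: for fixed $\mu,\nu,\beta$ in the stated range of validity, the ratio of the left-hand side to the right-hand side tends to $1$ as $x\to\infty$.
   Context: For real $\mu,\nu$ and $x>0$, the (normalised) modified Lommel function of the first kind is $$\tilde{t}_{\mu,\nu}(x)=\sum_{k=0}^\infty\frac{(\frac{1}{2}x)^{\mu+2k+1}}{\Gamma\big(k+\frac{\mu-\nu+3}{2}\big)\Gamma\big(k+\frac{\mu+\nu+3}{2}\big)},$$ where $1/\Gamma$ is taken to be $0$ at the poles of $\Gamma$. For $\mu+\nu>-1$ and $x>0$, $$B_{\mu,\nu,\beta}(x)=\frac{\beta^{-\mu-\nu-1}\gamma(\mu+\nu+1,\beta x)}{2^\mu\Gamma\big(\frac{\mu-\nu+1}{2}\big)\Gamma\big(\frac{\mu+\nu+3}{2}\big)},$$ where $\gamma(a,x)=\int_0^x\mathrm{e}^{-u}u^{a-1}\,\mathrm{d}u$ is the lower incomplete gamma function. *)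

(* Defs.v *)
From Stdlib Require Import ZArith Reals Lra.
From Coquelicot Require Import Coquelicot.
Open Scope R_scope.

(* Stdlib's [Rpower x y] is [exp (y * ln x)], the real power for [x > 0] only.
   All real powers below are taken at positive bases: the integrals start at
   [at_right 0], so that the value of the integrand at 0 is irrelevant and an
   integrable singularity at 0 is allowed. *)

(* Euler's integral; it converges exactly for [z > 0]. *)
Definition Gamma_int (z : R) : R :=
  RInt_gen (fun u => exp (- u) * Rpower u (z - 1))
           (at_right 0) (Rbar_locally p_infty).

(* z (z + 1) ... (z + n - 1) *)
Fixpoint rising (z : R) (n : nat) : R :=
  match n with
  | O => 1
  | S m => rising z m * (z + INR m)
  end.

(* The least [n] such that [z + n > 0]; it is 0 for [z > 0]. *)
Definition Gamma_shift (z : R) : nat := Z.to_nat (up (- z)).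

(* The Gamma function on the real line, extended from [z > 0] by
   Gamma (z + n) = z (z + 1) ... (z + n - 1) Gamma z. Its values at the poles
   0, -1, -2, ... are meaningless. *)
Definition Gamma (z : R) : R :=
  Gamma_int (z + INR (Gamma_shift z)) / rising z (Gamma_shift z).

(* The entire function 1 / Gamma: at the poles of Gamma the rising factorial
   vanishes, see [inv_Gamma_pole]. *)
Definition inv_Gamma (z : R) : R :=
  rising z (Gamma_shift z) / Gamma_int (z + INR (Gamma_shift z)).

Definition lower_gamma (a x : R) : R :=
  RInt_gen (fun u => exp (- u) * Rpower u (a - 1)) (at_right 0) (at_point x).

(* Normalised modified Lommel function of the first kind, for [x > 0]. *)
Definition lommel_t (mu nu x : R) : R :=
  Series (fun k : nat =>
    Rpower (x / 2) (mu + 2 * INR k + 1)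
    * inv_Gamma (INR k + (mu - nu + 3) / 2)
    * inv_Gamma (INR k + (mu + nu + 3) / 2)).

Definition lommel_B (mu nu beta x : R) : R :=
  Rpower beta (- mu - nu - 1) * lower_gamma (mu + nu + 1) (beta * x)
  / (Rpower 2 mu * Gamma ((mu - nu + 1) / 2) * Gamma ((mu + nu + 3) / 2)).

Lemma Gamma_shift_pos (z : R) : 0 < z -> Gamma_shift z = O.
Proof.
intros Hz; unfold Gamma_shift.
destruct (archimed (- z)) as [_ H].
assert (Hu : (up (- z) < 1)%Z) by (apply lt_IZR; lra).
destruct (up (- z)) as [|p|p]; [reflexivity | | reflexivity].
exfalso; exact (Z.lt_irrefl _ (Z.lt_le_trans _ _ _ Hu (Pos2Z.pos_le_pos _ _ (Pos.le_1_l p)))).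
Qed.

Lemma Gamma_pos_int (z : R) : 0 < z -> Gamma z = Gamma_int z.
Proof.
intros Hz; unfold Gamma; rewrite (Gamma_shift_pos z Hz); simpl.
rewrite Rplus_0_r; field.
Qed.

Lemma inv_Gamma_pole (n : nat) : inv_Gamma (- INR n) = 0.
Proof.
assert (Hs : Gamma_shift (- INR n) = S n).
{ unfold Gamma_shift; rewrite Ropp_involutive, INR_IZR_INZ.
  rewrite <- (tech_up (IZR (Z.of_nat n)) (Z.of_nat n + 1)).
  - rewrite Z.add_1_r, <- Nat2Z.inj_succ; apply Nat2Z.id.
  - rewrite plus_IZR; lra.
  - rewrite plus_IZR; lra. }
unfold inv_Gamma; rewrite Hs; cbn [rising].
replace (- INR n + INR n) with 0 by ring.
unfold Rdiv; ring.
Qed.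

Lemma inv_GammaE (z : R) : inv_Gamma z = / Gamma z.
Proof.
unfold inv_Gamma, Gamma, Rdiv.
rewrite Rinv_mult, Rinv_inv; ring.
Qed.

(* Main.v *)
Require Import Defs.
From Stdlib Require Import Reals Lra.
From Coquelicot Require Import Coquelicot.
Open Scope R_scope.

(** Fix [mu], [nu] and write p = t_{mu,nu}, f = t_{mu+1,nu+1},
    T(x) = exp (- beta x) x^nu p(x) and I(x) for the integral of T over (0, x).
    The coefficient recurrences of the two power series amount to

      p' = (nu / x) p + f + a,     f' = p - ((nu + 1) / x) f,

    where a is a constant multiple of x^mu, and B is exactly the primitive of
    exp (- beta x) x^nu a that vanishes at 0. Nearly every inequality below
    says that a function tending to 0 at 0 is positive, and is proved by looking
    at the sign of the derivative.

    - The excess (1 - beta) I - T + B has derivative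
      exp (- beta x) x^nu ((1 - 2 nu / x) p - f). For nu <= 0 the symmetry
      t_{mu,nu} = t_{mu,-nu} turns its positivity into
      t_{mu+1,n+1} < t_{mu,n} with n = - nu >= 0.
    - For nu > 1/2 one adds 2 nu W, with W the integral of T(u) / u: the
      derivative becomes exp (- beta x) x^nu (p - f) > 0. It remains to bound
      W by a multiple of T(x) / x ([lommel_int_pred_le]); the two bounds for
      nu > 1/2 in the theorem differ only in the multiple.
    - Both steps rest on [lommel_t_ratio_gt], the inequality
      (1 + (nu + 1/2) / x) f < p: the combination
      q = p - f - (nu + 1/2) f / x satisfies q' = - (1 + 1 / (2 x)) q + h with
      h > 0, hence exp (x) sqrt (x) q increases from 0.
    - For the bound by a series, put p_k = t_{mu+k,nu+k}. The formula for f'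
      gives exp (- beta x) x^nu p_{k+1} <= J_k - beta J_{k+1} where J_k is the
      integral of exp (- beta u) u^nu p_k. Multiplying by beta^k and summing
      over k telescopes ([lommel_weight_succ_le], [lommel_sum_le]).

    Tightness needs no asymptotic expansion of p. The quotient
    r = (p - f) / (p + f) lies in [-1, 1] and satisfies r' = - 2 r + O(1/x), so
    r = O(1/x) and f / p tends to 1 ([lommel_t_ratio_decays]). Hence
    T' / T = 1 - beta + O(1/x), and comparing derivatives with those of
    (c + K / x) T ([comparison_of_log_derivative]) gives
    I / T -> 1 / (1 - beta) and B / T -> 0. The series divided by p is squeezed
    between its partial sums, whose limits are those of the geometric series of
    ratio beta, and I / T. *)

(** * Monotonicity and primitives vanishing at zero *)

Lemma nondecreasing_of_derive (F f : R -> R) (u v : R) :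
  u <= v ->
  (forall x, u <= x <= v -> is_derive F x (f x)) ->
  (forall x, u <= x <= v -> 0 <= f x) ->
  F u <= F v.
Proof.
intros Huv HF Hf.
destruct (MVT_gen F u v f) as [c [Hc E]];
  rewrite ?Rmin_left, ?Rmax_right in * by lra.
- intros x Hx; apply HF; lra.
- intros x Hx; apply continuity_pt_filterlim.
  apply (ex_derive_continuous F x); exists (f x); apply HF; lra.
- assert (0 <= f c * (v - u)) by (apply Rmult_le_pos; [apply Hf|]; lra).
  lra.
Qed.

Lemma nonneg_of_derive (F f : R -> R) :
  (forall x, 0 < x -> is_derive F x (f x)) ->
  filterlim F (at_right 0) (locally 0) ->
  (forall x, 0 < x -> 0 <= f x) ->
  forall x, 0 < x -> 0 <= F x.
Proof.
intros HF HF0 Hf x Hx.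
apply Rnot_lt_le; intros Hneg.
assert (He : 0 < - F x) by lra.
destruct (HF0 _ (locally_ball 0 (mkposreal _ He))) as [d Hd].
pose (u := Rmin (d / 2) x).
assert (Hu : 0 < u /\ u <= d / 2 /\ u <= x).
{ unfold u; repeat split; [apply Rmin_glb_lt; [|lra] |apply Rmin_l|apply Rmin_r].
  generalize (cond_pos d); lra. }
assert (Hb : ball 0 (mkposreal _ He) (F u)).
{ apply Hd; [|lra].
  change (Rabs (u - 0) < d); rewrite Rabs_pos_eq by lra.
  generalize (cond_pos d); lra. }
change (Rabs (F u - 0) < - F x) in Hb.
apply Rabs_def2 in Hb.
assert (F u <= F x).
{ apply (nondecreasing_of_derive F f); [lra| |]; intros; [apply HF|apply Hf]; lra. }
lra.
Qed.

Lemma pos_of_derive (F f : R -> R) :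
  (forall x, 0 < x -> is_derive F x (f x)) ->
  filterlim F (at_right 0) (locally 0) ->
  (forall x, 0 < x -> 0 < f x) ->
  forall x, 0 < x -> 0 < F x.
Proof.
intros HF HF0 Hf x Hx.
assert (H0 : 0 <= F (x / 2)).
{ apply (nonneg_of_derive F f HF HF0); [|lra].
  intros y Hy; apply Rlt_le, Hf, Hy. }
destruct (MVT_gen F (x / 2) x f) as [c [Hc E]];
  rewrite ?Rmin_left, ?Rmax_right in * by lra.
- intros y Hy; apply HF; lra.
- intros y Hy; apply continuity_pt_filterlim.
  apply (ex_derive_continuous F y); exists (f y); apply HF; lra.
- assert (0 < f c * (x - x / 2)) by (apply Rmult_lt_0_compat; [apply Hf|]; lra).
  lra.
Qed.

Lemma Rpower_pos (x s : R) : 0 < Rpower x s.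
Proof. apply exp_pos. Qed.

Lemma is_derive_Rpower (s x : R) :
  0 < x -> is_derive (fun y => Rpower y s) x (s / x * Rpower x s).
Proof.
intros Hx; unfold Rpower; auto_derive; [assumption|field; lra].
Qed.

Lemma Rpower_cvg_0 (s : R) :
  0 < s -> filterlim (fun x => Rpower x s) (at_right 0) (locally 0).
Proof.
intros Hs.
apply (filterlim_comp _ _ _ (fun x => s * ln x) exp _ (Rbar_locally m_infty)).
- apply (filterlim_comp _ _ _ ln (Rmult s) _ (Rbar_locally m_infty)).
  + apply is_lim_ln_0.
  + intros P [M HM]; exists (M / s); intros x Hx; apply HM.
    apply (Rmult_lt_compat_l s) in Hx; [|assumption].
    replace (s * (M / s)) with M in Hx by (field; lra); assumption.
- apply is_lim_exp_m.
Qed.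

Lemma at_right_pos : at_right 0 (fun x => 0 < x).
Proof. exists (mkposreal 1 Rlt_0_1); intros; assumption. Qed.

Lemma cvg_0_right (g : R -> R) :
  continuous g 0 -> filterlim g (at_right 0) (locally (g 0)).
Proof.
intros Hg; apply (filterlim_filter_le_1 g (filter_le_within _)).
exact Hg.
Qed.

Lemma Rpower_mult_cvg_0 (s : R) (g : R -> R) :
  0 < s -> continuous g 0 ->
  filterlim (fun x => Rpower x s * g x) (at_right 0) (locally 0).
Proof.
intros Hs Hg.
replace 0 with (0 * g 0) at 2 by ring.
apply (filterlim_comp_2 (fun x => Rpower x s) g Rmult (Rpower_cvg_0 s Hs) (cvg_0_right g Hg)).
apply (filterlim_mult 0 (g 0)).
Qed.

(** A Cauchy criterion by comparison. It produces improper integrals at both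
    ends of (0, +oo), since only the increments of [F] are controlled, through
    those of a convergent [G]. *)
Lemma filterlim_of_increments {FF : (R -> Prop) -> Prop} {HFF : ProperFilter FF}
  (F G : R -> R) (l : R) (D : R -> Prop) :
  FF D ->
  (forall u v, D u -> D v -> u <= v -> Rabs (F v - F u) <= G v - G u) ->
  filterlim G FF (locally l) ->
  exists m : R, filterlim F FF (locally m).
Proof.
intros HD Hinc HG.
apply (proj1 (filterlim_locally_cauchy F)); intros eps.
destruct (proj2 (filterlim_locally_cauchy G) (ex_intro _ l HG) eps) as [P [HP HPG]].
exists (fun x => P x /\ D x); split; [apply filter_and; assumption|].
intros u v [Pu Du] [Pv Dv].
generalize (HPG u v Pu Pv).
change (Rabs (G v - G u) < eps -> Rabs (F v - F u) < eps); intros Hlt.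
destruct (Rle_dec u v) as [H|H].
- apply Rle_lt_trans with (2 := Hlt).
  apply Rle_trans with (2 := Rle_abs _); auto.
- rewrite Rabs_minus_sym in Hlt |- *.
  apply Rle_lt_trans with (2 := Hlt).
  apply Rle_trans with (2 := Rle_abs _); apply Hinc; auto; lra.
Qed.

Lemma increment_dominated (F G f g : R -> R) (u v : R) :
  u <= v ->
  (forall x, u <= x <= v -> is_derive F x (f x)) ->
  (forall x, u <= x <= v -> is_derive G x (g x)) ->
  (forall x, u <= x <= v -> Rabs (f x) <= g x) ->
  Rabs (F v - F u) <= G v - G u.
Proof.
intros Huv HF HG Hfg.
assert (Hm : G u - F u <= G v - F v).
{ apply (nondecreasing_of_derive (fun x => G x - F x) (fun x => g x - f x)); auto.
  - intros x Hx; apply (is_derive_minus G F x); auto.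
  - intros x Hx; generalize (Hfg x Hx) (Rle_abs (f x)); lra. }
assert (Hp : G u + F u <= G v + F v).
{ apply (nondecreasing_of_derive (fun x => G x + F x) (fun x => g x + f x)); auto.
  - intros x Hx; apply (is_derive_plus G F x); auto.
  - intros x Hx; generalize (Hfg x Hx) (Rle_abs (- f x)); rewrite Rabs_Ropp; lra. }
apply Rabs_le; lra.
Qed.

(** Improper integrals starting at 0 are handled through this predicate:
    [RInt_gen_primitive] identifies them with such primitives, after which the
    integrals enter the arguments only by their derivative and limit at 0. *)
Definition primitive_from_0 (f Phi : R -> R) : Prop :=
  (forall x, 0 < x -> is_derive Phi x (f x)) /\
  filterlim Phi (at_right 0) (locally 0).

Definition continuous_pos (f : R -> R) : Prop :=
  forall x, 0 < x -> continuous f x.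

(** Stated for an arbitrary upper filter because it serves both for an upper
    bound [x] and for the full Euler integral up to infinity. *)
Lemma is_RInt_gen_primitive {Fb : (R -> Prop) -> Prop} {HFb : Filter Fb}
  (f Phi : R -> R) (la lb : R) :
  continuous_pos f ->
  (forall x, 0 < x -> is_derive Phi x (f x)) ->
  filterlim Phi (at_right 0) (locally la) ->
  Fb (fun b => 0 < b) ->
  filterlim Phi Fb (locally lb) ->
  is_RInt_gen f (at_right 0) Fb (lb - la).
Proof.
intros Cf HPhi Ha Hb Hlb.
assert (Hpos : filter_prod (at_right 0) Fb
  (fun ab : R * R => forall x, Rmin (fst ab) (snd ab) <= x -> 0 < x)).
{ exists (fun a => 0 < a) (fun b => 0 < b); [apply at_right_pos|assumption|].
  intros a b Pa Pb x; simpl; unfold Rmin; destruct Rle_dec; lra. }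
apply is_RInt_gen_ext with (f := Derive Phi).
- revert Hpos; apply filter_imp; intros ab H x Hx.
  apply is_derive_unique, HPhi, H; lra.
- apply is_RInt_gen_Derive; [| |assumption|assumption];
  (revert Hpos; apply filter_imp; intros ab H x [Hx _]; specialize (H x Hx)).
  + exists (f x); apply HPhi, H.
  + apply continuous_ext_loc with (g := f); [|apply Cf, H].
    exists (mkposreal x H); intros y Hy.
    change (Rabs (y - x) < x) in Hy; apply Rabs_def2 in Hy.
    symmetry; apply is_derive_unique, HPhi; lra.
Qed.

Lemma RInt_gen_primitive (f Phi : R -> R) (x : R) :
  continuous_pos f -> primitive_from_0 f Phi -> 0 < x ->
  RInt_gen f (at_right 0) (at_point x) = Phi x.
Proof.
intros Cf [HPhi H0] Hx.
apply is_RInt_gen_unique.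
replace (Phi x) with (Phi x - 0) by ring.
apply is_RInt_gen_primitive with (Phi := Phi); auto.
intros P HP; unfold filtermap, at_point; apply locally_singleton, HP.
Qed.

Lemma continuous_pos_primitive (f : R -> R) :
  continuous_pos f ->
  forall x, 0 < x -> is_derive (fun y => RInt f 1 y) x (f x).
Proof.
intros Cf x Hx.
apply (is_derive_RInt f _ 1); [|apply Cf, Hx].
exists (mkposreal x Hx); intros y Hy.
change (Rabs (y - x) < x) in Hy; apply Rabs_def2 in Hy.
apply (RInt_correct f), ex_RInt_continuous; intros z Hz; apply Cf.
revert Hz; unfold Rmin; destruct Rle_dec; lra.
Qed.

Lemma continuous_pos_Rpower_mult (s : R) (g : R -> R) :
  (forall x, continuous g x) -> continuous_pos (fun x => Rpower x s * g x).
Proof.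
intros Cg x Hx.
apply (continuous_mult (fun x => Rpower x s) g); [|apply Cg].
apply (ex_derive_continuous (fun x => Rpower x s)).
eexists; apply is_derive_Rpower, Hx.
Qed.

(** Near 0 the function [g] is bounded by some [C], so that the integrand is
    dominated by [C x^s], whose primitive [C x^(s+1) / (s+1)] has a limit at 0.
    All integrands below are of this form. *)
Lemma ex_primitive_from_0 (s : R) (g : R -> R) :
  -1 < s -> (forall x, continuous g x) ->
  exists Phi, primitive_from_0 (fun x => Rpower x s * g x) Phi.
Proof.
intros Hs Cg.
set (f := fun x => Rpower x s * g x).
assert (Cf : continuous_pos f) by (apply continuous_pos_Rpower_mult, Cg).
assert (HF := continuous_pos_primitive f Cf).
set (F := fun y => RInt f 1 y) in HF.
pose (C := Rabs (g 0) + 1).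
assert (HC : 0 < C) by (unfold C; generalize (Rabs_pos (g 0)); lra).
destruct (Cg 0 _ (locally_ball (g 0) (mkposreal 1 Rlt_0_1))) as [d Hd].
assert (Hg : forall x, 0 < x < d -> Rabs (g x) <= C).
{ intros x Hx.
  assert (H : Rabs (g x - g 0) < 1).
  { apply (Hd x); change (Rabs (x - 0) < d); rewrite Rabs_pos_eq; lra. }
  unfold C; replace (g x) with (g 0 + (g x - g 0)) by ring.
  apply Rle_trans with (1 := Rabs_triang _ _); lra. }
destruct (@filterlim_of_increments (at_right 0) _ F
  (fun x => Rpower x (s + 1) * (C / (s + 1))) 0 (fun x => 0 < x < d)) as [m Hm].
- exists d; intros x Hx Px; split; [assumption|].
  change (Rabs (x - 0) < d) in Hx; rewrite Rabs_pos_eq in Hx; lra.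
- intros u v Hu Hv Huv.
  apply (increment_dominated F (fun x => Rpower x (s + 1) * (C / (s + 1))) f
           (fun x => Rpower x s * C)); auto.
  + intros x Hx; apply HF; lra.
  + intros x Hx.
    assert (Hx0 : 0 < x) by lra.
    assert (HR := is_derive_Rpower (s + 1) x Hx0).
    auto_derive; [eexists; apply HR|].
    replace (Derive _ x) with ((s + 1) / x * Rpower x (s + 1))
      by (symmetry; apply is_derive_unique, HR).
    rewrite Rpower_plus, Rpower_1 by lra; field; lra.
  + intros x Hx; unfold f; rewrite Rabs_mult, (Rabs_pos_eq (Rpower x s))
      by apply Rlt_le, Rpower_pos.
    apply Rmult_le_compat_l; [apply Rlt_le, Rpower_pos|apply Hg; lra].
- apply Rpower_mult_cvg_0; [lra|apply continuous_const].
- exists (fun x => F x - m); split.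
  + intros x Hx; replace (f x) with (f x - 0) by ring.
    apply (is_derive_minus F (fun _ => m) x); [apply HF, Hx|apply (is_derive_const m)].
  + replace 0 with (m + - m) at 2 by ring.
    apply (filterlim_comp_2 F (fun _ => - m) Rplus Hm (filterlim_const (- m))).
    apply (filterlim_plus m (- m)).
Qed.

Lemma primitive_RInt_gen (f : R -> R) :
  continuous_pos f -> (exists Phi, primitive_from_0 f Phi) ->
  primitive_from_0 f (fun x => RInt_gen f (at_right 0) (at_point x)).
Proof.
intros Cf [Phi HPhi].
assert (E : forall x, 0 < x -> Phi x = RInt_gen f (at_right 0) (at_point x)).
{ intros x Hx; symmetry; apply RInt_gen_primitive; assumption. }
destruct HPhi as [H1 H2]; split.
- intros x Hx; apply is_derive_ext_loc with Phi; [|apply H1, Hx].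
  exists (mkposreal x Hx); intros y Hy; apply E.
  change (Rabs (y - x) < x) in Hy; apply Rabs_def2 in Hy; lra.
- apply filterlim_ext_loc with Phi; [|assumption].
  generalize at_right_pos; apply filter_imp, E.
Qed.

Lemma Rpower_pred (x s : R) : 0 < x -> Rpower x (s - 1) = Rpower x s / x.
Proof.
intros Hx; unfold Rminus; rewrite Rpower_plus, Rpower_Ropp, Rpower_1 by assumption.
reflexivity.
Qed.

Lemma cvg_0_plus {FF : (R -> Prop) -> Prop} {HFF : Filter FF} (F G : R -> R) :
  filterlim F FF (locally 0) -> filterlim G FF (locally 0) ->
  filterlim (fun x => F x + G x) FF (locally 0).
Proof.
intros HF HG; replace 0 with (0 + 0) by ring.
apply (filterlim_comp_2 F G Rplus HF HG), (filterlim_plus (0 : R) (0 : R)).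
Qed.

Lemma cvg_0_scal {FF : (R -> Prop) -> Prop} {HFF : Filter FF} (k : R) (F : R -> R) :
  filterlim F FF (locally 0) -> filterlim (fun x => k * F x) FF (locally 0).
Proof.
intros HF; replace 0 with (k * 0) by ring.
apply (filterlim_comp _ _ _ F (Rmult k) _ _ _ HF), (filterlim_scal_r k (0 : R)).
Qed.

(** * The Gamma function on the positive half-line *)

Definition gamma_density (z u : R) : R := exp (- u) * Rpower u (z - 1).

Lemma gamma_density_continuous (z : R) : continuous_pos (gamma_density z).
Proof.
intros x Hx; apply (ex_derive_continuous (gamma_density z)).
unfold gamma_density, Rpower; auto_derive; assumption.
Qed.

Lemma ex_gamma_primitive (z : R) :
  0 < z -> exists Phi, primitive_from_0 (gamma_density z) Phi.
Proof.
intros Hz.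
destruct (ex_primitive_from_0 (z - 1) (fun u => exp (- u))) as [Phi [H1 H2]].
- lra.
- intros x; apply (ex_derive_continuous (fun u => exp (- u))); auto_derive; exact I.
- exists Phi; split; [|assumption].
  intros x Hx; unfold gamma_density; rewrite Rmult_comm; apply H1, Hx.
Qed.

Lemma lower_gamma_primitive (z : R) :
  0 < z -> primitive_from_0 (gamma_density z) (lower_gamma z).
Proof.
intros Hz.
apply primitive_RInt_gen; [apply gamma_density_continuous|apply ex_gamma_primitive, Hz].
Qed.

(** From [ln u = ln (u / c) + ln c <= u / c + ln c], where [c] is taken large
    enough for the linear term to stay below [u / 2]. *)
Lemma Rpower_le_exp_half (w : R) :
  exists C, 0 < C /\ forall u, 0 < u -> 1 <= u -> Rpower u w <= C * exp (u / 2).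
Proof.
set (c := 2 * (Rabs w + 1)).
assert (Hw := Rabs_pos w).
exists (exp (Rabs w * ln c)); split; [apply exp_pos|].
intros u Hu Hu1; unfold Rpower; rewrite <- exp_plus.
assert (Hc : 0 < c) by (unfold c; lra).
assert (Hln : ln u <= u / c + ln c).
{ replace u with (c * (u / c)) at 1 by (field; lra).
  assert (0 < u / c) by (apply Rdiv_lt_0_compat; lra).
  rewrite ln_mult by lra.
  assert (H1 := exp_ineq1_le (ln (u / c))); rewrite exp_ln in H1 by lra; lra. }
assert (Hln0 : 0 <= ln u) by (rewrite <- ln_1; apply ln_le; lra).
assert (H1 : w * ln u <= Rabs w * (u / c + ln c)).
{ apply Rle_trans with (Rabs w * ln u).
  - apply Rmult_le_compat_r; [assumption|apply Rle_abs].
  - apply Rmult_le_compat_l; assumption. }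
assert (H2 : Rabs w * (u / c) <= u / 2).
{ apply Rle_trans with ((Rabs w + 1) * (u / c)).
  - apply Rmult_le_compat_r; [|lra]; apply Rlt_le, Rdiv_lt_0_compat; lra.
  - right; unfold c; field; lra. }
destruct (Rle_lt_or_eq_dec _ _ (Rle_trans _ _ (Rabs w * ln c + u / 2) H1 ltac:(lra))) as [H|H].
- left; apply exp_increasing, H.
- right; rewrite H; reflexivity.
Qed.

Lemma gamma_density_le (z : R) :
  exists C, 0 < C /\ forall u, 1 <= u -> gamma_density z u <= C * exp (- u / 2).
Proof.
destruct (Rpower_le_exp_half (z - 1)) as [C [HC H]]; exists C; split; [assumption|].
intros u Hu; unfold gamma_density.
replace (exp (- u / 2)) with (exp (- u) * exp (u / 2))
  by (rewrite <- exp_plus; f_equal; field).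
assert (Hp := exp_pos (- u)).
specialize (H u ltac:(lra) Hu); nra.
Qed.

Lemma exp_opp_half_cvg : filterlim (fun u => exp (- u / 2)) (Rbar_locally p_infty) (locally 0).
Proof.
apply (filterlim_comp _ _ _ (fun u => - u / 2) exp _ (Rbar_locally m_infty)).
- intros P [M HM]; exists (- 2 * M); intros x Hx; apply HM; lra.
- apply is_lim_exp_m.
Qed.

(** Convergence at infinity by comparison with [exp (- u / 2)]. *)
Lemma lower_gamma_lim (z : R) :
  0 < z ->
  exists l, 0 < l /\ filterlim (lower_gamma z) (Rbar_locally p_infty) (locally l).
Proof.
intros Hz.
destruct (lower_gamma_primitive z Hz) as [HF H0].
destruct (gamma_density_le z) as [C [HC Hle]].
assert (Hpos : forall x, 0 < x -> 0 < gamma_density z x).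
{ intros x Hx; apply Rmult_lt_0_compat; apply exp_pos. }
destruct (@filterlim_of_increments (Rbar_locally p_infty) _ (lower_gamma z)
  (fun x => - 2 * C * exp (- x / 2)) 0 (fun x => 1 < x)) as [l Hl].
- exists 1; auto.
- intros u v Hu Hv Huv.
  apply (increment_dominated (lower_gamma z) (fun x => - 2 * C * exp (- x / 2))
           (gamma_density z) (fun x => C * exp (- x / 2))); auto.
  + intros x Hx; apply HF; lra.
  + intros x Hx; auto_derive; [exact I|].
    replace (- x * / 2) with (- x / 2) by reflexivity; field.
  + intros x Hx; rewrite Rabs_pos_eq; [apply Hle; lra|].
    apply Rlt_le, Hpos; lra.
- apply cvg_0_scal, exp_opp_half_cvg.
- exists l; split; [|assumption].
  assert (H1 := pos_of_derive _ _ HF H0 Hpos 1 Rlt_0_1).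
  apply Rlt_le_trans with (1 := H1).
  apply (filterlim_le (F := Rbar_locally p_infty) (fun _ => lower_gamma z 1) (lower_gamma z)
    (lower_gamma z 1) l); [|apply filterlim_const|assumption].
  exists 1; intros x Hx.
  apply (nondecreasing_of_derive _ (gamma_density z)); [lra| |]; intros y Hy.
  + apply HF; lra.
  + apply Rlt_le, Hpos; lra.
Qed.

Lemma Gamma_int_lim (z : R) :
  0 < z ->
  filterlim (lower_gamma z) (Rbar_locally p_infty) (locally (Gamma_int z)) /\ 0 < Gamma_int z.
Proof.
intros Hz.
destruct (lower_gamma_lim z Hz) as [l [Hl0 Hl]].
destruct (lower_gamma_primitive z Hz) as [HF H0].
assert (E : Gamma_int z = l).
{ apply is_RInt_gen_unique.
  replace l with (l - 0) by ring.
  apply (is_RInt_gen_primitive (gamma_density z) (lower_gamma z)); auto.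
  - apply gamma_density_continuous.
  - exists 0; auto. }
rewrite E; auto.
Qed.

Lemma gamma_density_cvg_0 (z : R) :
  filterlim (gamma_density z) (Rbar_locally p_infty) (locally 0).
Proof.
destruct (gamma_density_le z) as [C [HC Hle]].
apply filterlim_le_le with (f := fun _ => 0) (h := fun u => C * exp (- u / 2)) (l := 0).
- exists 1; intros x Hx; split; [|apply Hle; lra].
  apply Rlt_le, Rmult_lt_0_compat; apply exp_pos.
- apply filterlim_const.
- apply (cvg_0_scal C), exp_opp_half_cvg.
Qed.

(** Integration by parts: both sides are primitives of the same density
    vanishing at 0. *)
Lemma lower_gamma_succ (z x : R) :
  0 < z -> 0 < x ->
  lower_gamma (z + 1) x = z * lower_gamma z x - gamma_density (z + 1) x.
Proof.
intros Hz Hx.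
destruct (lower_gamma_primitive z Hz) as [HF HF0].
apply (RInt_gen_primitive (gamma_density (z + 1))
  (fun x => z * lower_gamma z x - gamma_density (z + 1) x));
  [apply gamma_density_continuous| |assumption].
unfold gamma_density; replace (z + 1 - 1) with z by ring.
split.
- intros y Hy.
  assert (HR := is_derive_Rpower z y Hy).
  auto_derive.
  + repeat split; [exists (gamma_density z y); apply HF, Hy|eexists; apply HR].
  + replace (Derive (fun x => lower_gamma z x) y) with (gamma_density z y)
      by (symmetry; apply is_derive_unique, HF, Hy).
    replace (Derive (fun x => Rpower x z) y) with (z / y * Rpower y z)
      by (symmetry; apply is_derive_unique, HR).
    unfold gamma_density, Rminus.
    rewrite Rpower_plus, Rpower_Ropp, Rpower_1 by lra; field; lra.
- apply filterlim_ext with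
    (fun x => z * lower_gamma z x + -1 * (Rpower x z * exp (- x))); [intros; ring|].
  apply cvg_0_plus; apply cvg_0_scal; [assumption|].
  apply Rpower_mult_cvg_0; [assumption|].
  apply (ex_derive_continuous (fun u => exp (- u))); auto_derive; exact I.
Qed.

Lemma Gamma_int_succ (z : R) : 0 < z -> Gamma_int (z + 1) = z * Gamma_int z.
Proof.
intros Hz.
destruct (Gamma_int_lim z Hz) as [HF _].
destruct (Gamma_int_lim (z + 1) ltac:(lra)) as [HG _].
apply (filterlim_locally_unique (F := Rbar_locally p_infty) (lower_gamma (z + 1)));
  [assumption|].
apply filterlim_ext_loc with (fun x => z * lower_gamma z x + - gamma_density (z + 1) x).
{ exists 0; intros x Hx; symmetry; rewrite lower_gamma_succ by assumption; ring. }
replace (z * Gamma_int z) with (z * Gamma_int z + - 0) by ring.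
apply (filterlim_comp_2 (fun x => z * lower_gamma z x) (fun x => - gamma_density (z + 1) x)
  Rplus (G := locally (z * Gamma_int z)) (H := locally (- 0))).
- apply (filterlim_comp _ _ _ (lower_gamma z) (Rmult z) _ _ _ HF).
  apply (filterlim_scal_r z (Gamma_int z)).
- apply (filterlim_comp _ _ _ (gamma_density (z + 1)) Ropp _ _ _ (gamma_density_cvg_0 _)).
  apply (filterlim_opp (0 : R)).
- apply (filterlim_plus (z * Gamma_int z) (- 0)).
Qed.

Lemma inv_Gamma_pos_int (z : R) : 0 < z -> inv_Gamma z = / Gamma_int z.
Proof. intros Hz; rewrite inv_GammaE, Gamma_pos_int by assumption; reflexivity. Qed.

Lemma inv_Gamma_pos (z : R) : 0 < z -> 0 < inv_Gamma z.
Proof.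
intros Hz; rewrite inv_Gamma_pos_int by assumption.
apply Rinv_0_lt_compat, Gamma_int_lim, Hz.
Qed.

Lemma inv_Gamma_0 : inv_Gamma 0 = 0.
Proof. generalize (inv_Gamma_pole 0); simpl; rewrite Ropp_0; auto. Qed.

Lemma inv_Gamma_nonneg (z : R) : 0 <= z -> 0 <= inv_Gamma z.
Proof.
intros [Hz| <-]; [apply Rlt_le, inv_Gamma_pos, Hz|rewrite inv_Gamma_0; lra].
Qed.

(** The case [z = 0] is included: there the left factor and the value of
    [inv_Gamma] at the pole both vanish. It is what makes [nu = mu + 3] behave
    like the other parameters. *)
Lemma inv_Gamma_succ (z : R) : 0 <= z -> z * inv_Gamma (z + 1) = inv_Gamma z.
Proof.
intros [Hz| <-]; [|rewrite inv_Gamma_0; ring].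
rewrite !inv_Gamma_pos_int, Gamma_int_succ by lra.
destruct (Gamma_int_lim z Hz) as [_ H]; field; lra.
Qed.

(** * The power series of the Lommel function *)

(** The coefficients with [a = (mu - nu + 3) / 2] and [b = (mu + nu + 3) / 2];
    replacing [(mu, nu)] by [(mu + 1, nu + 1)] keeps [a] and adds 1 to [b]. *)
Definition lcoef (a b : R) (k : nat) : R :=
  inv_Gamma (INR k + a) * inv_Gamma (INR k + b).

Lemma lcoef_nonneg (a b : R) (k : nat) : 0 <= a -> 0 < b -> 0 <= lcoef a b k.
Proof.
intros Ha Hb; assert (H := pos_INR k).
apply Rmult_le_pos; apply inv_Gamma_nonneg; lra.
Qed.

Lemma lcoef_pos (a b : R) (k : nat) : 0 < INR k + a -> 0 < b -> 0 < lcoef a b k.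
Proof.
intros Ha Hb; assert (H := pos_INR k).
apply Rmult_lt_0_compat; apply inv_Gamma_pos; lra.
Qed.

Lemma lcoef_succ_r (a b : R) (k : nat) :
  0 < b -> (INR k + b) * lcoef a (b + 1) k = lcoef a b k.
Proof.
intros Hb; unfold lcoef.
rewrite <- (inv_Gamma_succ (INR k + b)) by (generalize (pos_INR k); lra).
rewrite Rplus_assoc; ring.
Qed.

Lemma lcoef_succ_l (a b : R) (k : nat) :
  0 <= a -> (INR k + a) * lcoef a b (S k) = lcoef a (b + 1) k.
Proof.
intros Ha; unfold lcoef; rewrite S_INR.
rewrite <- (inv_Gamma_succ (INR k + a)) by (generalize (pos_INR k); lra).
replace (INR k + 1 + a) with (INR k + a + 1) by ring.
replace (INR k + 1 + b) with (INR k + (b + 1)) by ring.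
ring.
Qed.

(** The ratio test is applied after dropping the coefficient of index 0, which
    vanishes when [a = 0]. *)
Lemma CV_radius_lcoef (a b : R) : 0 <= a -> 0 < b -> CV_radius (lcoef a b) = p_infty.
Proof.
intros Ha Hb; rewrite <- CV_radius_decr_1.
assert (Hp : forall n, 0 < PS_decr_1 (lcoef a b) n).
{ intros n; apply lcoef_pos; [|assumption]; rewrite S_INR; generalize (pos_INR n); lra. }
apply CV_radius_infinite_DAlembert.
{ intros n; generalize (Hp n); lra. }
apply is_lim_seq_le_le with (u := fun _ => 0) (w := fun n => / INR (S n)).
- intros n.
  assert (Hn := pos_INR n).
  assert (H0 := Hp n); assert (H1 := Hp (S n)).
  assert (E : lcoef a b (S n) = (INR n + 1 + a) * (INR n + 1 + b) * lcoef a b (S (S n))).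
  { rewrite <- (lcoef_succ_r a b (S n)), <- (lcoef_succ_l a b (S n)), S_INR by assumption.
    ring. }
  unfold PS_decr_1 in *.
  rewrite Rabs_pos_eq; [|apply Rlt_le, Rdiv_lt_0_compat; assumption].
  split; [apply Rlt_le, Rdiv_lt_0_compat; assumption|].
  rewrite E, S_INR.
  apply Rmult_le_reg_r with ((INR n + 1 + a) * (INR n + 1 + b) * (INR n + 1)).
  { repeat apply Rmult_lt_0_compat; lra. }
  field_simplify; [|lra|nra].
  assert (0 <= INR n * INR n) by nra.
  assert (0 <= INR n * b) by nra.
  assert (0 <= INR n * a) by nra.
  assert (0 <= a * b) by nra.
  nra.
- apply is_lim_seq_const.
- apply (is_lim_seq_incr_1 (fun n => / INR n)).
  apply (is_lim_seq_inv INR p_infty); [apply is_lim_seq_INR|discriminate].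
Qed.

(** The range of parameters in which all coefficients are nonnegative and at
    most the first one vanishes. It is stable under
    [(mu, nu) -> (mu + 1, nu + 1)]. *)
Definition admissible (mu nu : R) : Prop := 0 <= (mu - nu + 3) / 2 /\ 0 < (mu + nu + 3) / 2.

Definition lommel_coef (mu nu : R) : nat -> R :=
  lcoef ((mu - nu + 3) / 2) ((mu + nu + 3) / 2).

Definition lommel_series (mu nu y : R) : R := PSeries (lommel_coef mu nu) y.

Lemma ex_lommel_series (mu nu y : R) :
  admissible mu nu -> Rbar_lt (Rabs y) (CV_radius (lommel_coef mu nu)).
Proof. intros [Ha Hb]; unfold lommel_coef; rewrite CV_radius_lcoef by assumption; exact I. Qed.

Lemma lommel_tE (mu nu x : R) : 0 < x ->
  lommel_t mu nu x = Rpower (x / 2) (mu + 1) * lommel_series mu nu ((x / 2) ^ 2).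
Proof.
intros Hx; unfold lommel_t, lommel_series, PSeries; rewrite <- Series_scal_l.
apply Series_ext; intros k; unfold lommel_coef, lcoef.
rewrite <- pow_mult.
replace (mu + 2 * INR k + 1) with (mu + 1 + INR (2 * k)) by (rewrite mult_INR; simpl; ring).
rewrite Rpower_plus, Rpower_pow by lra; ring.
Qed.

Lemma lommel_t_opp (mu nu x : R) : lommel_t mu (- nu) x = lommel_t mu nu x.
Proof.
apply Series_ext; intros k.
replace (mu - - nu + 3) with (mu + nu + 3) by ring.
replace (mu + - nu + 3) with (mu - nu + 3) by ring.
ring.
Qed.

Lemma PSeries_nonneg (c : nat -> R) (y : R) :
  0 <= y -> (forall k, 0 <= c k) -> ex_pseries c y -> 0 <= PSeries c y.
Proof.
intros Hy Hc Hex; apply ex_pseries_R in Hex.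
assert (E : forall k, Rabs (c k * y ^ k) = c k * y ^ k).
{ intros k; apply Rabs_pos_eq, Rmult_le_pos; [apply Hc|apply pow_le, Hy]. }
unfold PSeries; rewrite <- (Series_ext _ _ E).
apply Rle_trans with (1 := Rabs_pos (Series (fun k => c k * y ^ k))), Series_Rabs.
apply ex_series_ext with (2 := Hex); intros; symmetry; apply E.
Qed.

(** The term of index 1 is kept rather than that of index 0, as the latter
    vanishes for [nu = mu + 3]. The extra factor [y] is also what makes
    [lommel_source] negligible at infinity. *)
Lemma lommel_series_ge (mu nu y : R) :
  admissible mu nu -> 0 <= y -> lommel_coef mu nu 1 * y <= lommel_series mu nu y.
Proof.
intros HA Hy; unfold lommel_series.
assert (Hc : forall k, 0 <= lommel_coef mu nu k) by (intros k; apply lcoef_nonneg; apply HA).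
assert (Hex := ex_lommel_series mu nu y HA).
rewrite PSeries_decr_1 by apply CV_radius_inside, Hex.
rewrite PSeries_decr_1 by (apply CV_radius_inside; rewrite CV_radius_decr_1; apply Hex).
assert (H : 0 <= PSeries (PS_decr_1 (PS_decr_1 (lommel_coef mu nu))) y).
{ apply PSeries_nonneg; [assumption|intros k; apply Hc|].
  apply CV_radius_inside; rewrite !CV_radius_decr_1; apply Hex. }
generalize (Hc 0%nat); unfold PS_decr_1 at 1; nra.
Qed.

Lemma lommel_t_ge (mu nu : R) :
  admissible mu nu ->
  exists c, 0 < c /\ forall x, 0 < x -> c * Rpower (x / 2) (mu + 3) <= lommel_t mu nu x.
Proof.
intros HA; exists (lommel_coef mu nu 1); split.
{ apply lcoef_pos; [|apply HA]; destruct HA; simpl; lra. }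
intros x Hx; rewrite lommel_tE by assumption.
replace (mu + 3) with (mu + 1 + INR 2) by (simpl; ring).
rewrite Rpower_plus, Rpower_pow by lra.
assert (Hp := Rpower_pos (x / 2) (mu + 1)).
assert (H := lommel_series_ge mu nu ((x / 2) ^ 2) HA (pow2_ge_0 _)).
nra.
Qed.

Lemma lommel_t_pos (mu nu x : R) : admissible mu nu -> 0 < x -> 0 < lommel_t mu nu x.
Proof.
intros HA Hx; destruct (lommel_t_ge mu nu HA) as [c [Hc H]].
apply Rlt_le_trans with (2 := H x Hx), Rmult_lt_0_compat; [assumption|apply Rpower_pos].
Qed.

Lemma admissible_succ (mu nu : R) : admissible mu nu -> admissible (mu + 1) (nu + 1).
Proof. unfold admissible; lra. Qed.

Lemma is_derive_lommel_series (mu nu y : R) :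
  admissible mu nu ->
  is_derive (lommel_series mu nu) y (PSeries (PS_derive (lommel_coef mu nu)) y).
Proof. intros HA; apply is_derive_PSeries, ex_lommel_series, HA. Qed.

Lemma euler_coef (c : nat -> R) (s : R) (k : nat) :
  PS_plus (PS_incr_1 (PS_derive c)) (PS_scal s c) k = (INR k + s) * c k.
Proof.
destruct k as [|k].
- assert (E : 0 + s * c 0%nat = (0 + s) * c 0%nat) by ring; exact E.
- assert (E : INR (S k) * c (S k) + s * c (S k) = (INR (S k) + s) * c (S k)) by ring.
  exact E.
Qed.

(** The operator [y d/dy + s] multiplies the coefficient of index [k] by
    [k + s]. *)
Lemma euler_PSeries (c : nat -> R) (s y : R) :
  Rbar_lt (Rabs y) (CV_radius c) ->
  y * PSeries (PS_derive c) y + s * PSeries c y = PSeries (fun k => (INR k + s) * c k) y.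
Proof.
intros Hc.
rewrite <- PSeries_incr_1, <- PSeries_scal, <- PSeries_plus.
- apply PSeries_ext; intros k; apply euler_coef.
- apply ex_pseries_incr_1, ex_pseries_derive, Hc.
- apply ex_pseries_scal; [apply Rmult_comm|apply CV_radius_inside, Hc].
Qed.

Lemma lommel_series_lower (mu nu y : R) :
  admissible mu nu ->
  y * PSeries (PS_derive (lommel_coef (mu + 1) (nu + 1))) y
    + (mu + nu + 3) / 2 * lommel_series (mu + 1) (nu + 1) y
  = lommel_series mu nu y.
Proof.
intros HA; unfold lommel_series.
rewrite euler_PSeries by apply ex_lommel_series, admissible_succ, HA.
apply PSeries_ext; intros k; unfold lommel_coef.
replace (mu + 1 - (nu + 1) + 3) with (mu - nu + 3) by ring.
replace ((mu + 1 + (nu + 1) + 3) / 2) with ((mu + nu + 3) / 2 + 1) by field.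
apply lcoef_succ_r, HA.
Qed.

Lemma lommel_series_raise (mu nu y : R) :
  admissible mu nu ->
  y * PSeries (PS_derive (lommel_coef mu nu)) y
    + (mu - nu + 1) / 2 * lommel_series mu nu y
  = (mu - nu + 1) / 2 * lommel_coef mu nu 0 + y * lommel_series (mu + 1) (nu + 1) y.
Proof.
intros HA; unfold lommel_series.
assert (Hex := ex_lommel_series mu nu y HA).
rewrite euler_PSeries by exact Hex.
assert (E : forall k, PS_decr_1 (fun k => (INR k + (mu - nu + 1) / 2) * lommel_coef mu nu k) k
  = lommel_coef (mu + 1) (nu + 1) k).
{ intros k; unfold PS_decr_1, lommel_coef.
  replace (mu + 1 - (nu + 1) + 3) with (mu - nu + 3) by ring.
  replace ((mu + 1 + (nu + 1) + 3) / 2) with ((mu + nu + 3) / 2 + 1) by field.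
  rewrite <- lcoef_succ_l by apply HA; rewrite S_INR.
  apply (f_equal (fun t => t * _)); field. }
rewrite PSeries_decr_1, (PSeries_ext _ _ y E).
{ change (INR 0) with 0; rewrite Rplus_0_l; reflexivity. }
apply ex_pseries_ext with (PS_plus (PS_incr_1 (PS_derive (lommel_coef mu nu)))
                            (PS_scal ((mu - nu + 1) / 2) (lommel_coef mu nu))).
{ intros k; apply euler_coef. }
apply ex_pseries_plus.
- apply ex_pseries_incr_1, ex_pseries_derive, Hex.
- apply ex_pseries_scal; [apply Rmult_comm|apply CV_radius_inside, Hex].
Qed.

(** The inhomogeneous term of Lommel's recurrence
    t_{mu-1,nu+1} - t_{mu+1,nu+1}, usually written
    (x/2)^mu / (Gamma ((mu-nu+1)/2) Gamma ((mu+nu+3)/2)). The form chosen here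
    avoids reciprocal Gamma values at negative arguments. *)
Definition lommel_source (mu nu x : R) : R :=
  (mu - nu + 1) / 2 * lommel_coef mu nu 0 * Rpower (x / 2) mu.

Lemma is_derive_lommel_t_aux (mu nu x : R) :
  admissible mu nu -> 0 < x ->
  is_derive (lommel_t mu nu) x
    (2 / x * Rpower (x / 2) (mu + 1) *
      ((mu + 1) / 2 * lommel_series mu nu ((x / 2) ^ 2)
       + (x / 2) ^ 2 * PSeries (PS_derive (lommel_coef mu nu)) ((x / 2) ^ 2))).
Proof.
intros HA Hx.
apply is_derive_ext_loc with
  (fun x => Rpower (x / 2) (mu + 1) * lommel_series mu nu ((x / 2) ^ 2)).
{ exists (mkposreal x Hx); intros y Hy; symmetry; apply lommel_tE.
  change (Rabs (y - x) < x) in Hy; apply Rabs_def2 in Hy; lra. }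
assert (HL := is_derive_lommel_series mu nu ((x / 2) ^ 2) HA).
assert (HR := is_derive_Rpower (mu + 1) (x / 2) ltac:(lra)).
auto_derive.
- repeat split; [eexists; apply HR|eexists; apply HL].
- replace (x * / 2 * (x * / 2 * 1)) with ((x / 2) ^ 2) by (simpl; unfold Rdiv; ring).
  replace (x * / 2) with (x / 2) by reflexivity.
  replace (Derive (fun x => Rpower x (mu + 1)) (x / 2))
    with ((mu + 1) / (x / 2) * Rpower (x / 2) (mu + 1))
    by (symmetry; apply is_derive_unique, HR).
  replace (Derive (fun x => lommel_series mu nu x) ((x / 2) ^ 2))
    with (PSeries (PS_derive (lommel_coef mu nu)) ((x / 2) ^ 2))
    by (symmetry; apply is_derive_unique, HL).
  field; lra.
Qed.

(** Equivalent to (x^nu t_{mu,nu})' = x^nu t_{mu-1,nu-1} with both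
    indices raised by 1. *)
Lemma is_derive_lommel_t_lower (mu nu x : R) :
  admissible mu nu -> 0 < x ->
  is_derive (lommel_t (mu + 1) (nu + 1)) x
    (lommel_t mu nu x - (nu + 1) / x * lommel_t (mu + 1) (nu + 1) x).
Proof.
intros HA Hx.
evar_last; [apply is_derive_lommel_t_aux; [apply admissible_succ, HA|assumption]|].
rewrite !lommel_tE, <- (lommel_series_lower mu nu) by assumption.
replace (mu + 1 + 1) with (mu + 1 + INR 1) by (simpl; ring).
rewrite (Rpower_plus (mu + 1)), Rpower_pow by lra.
simpl (INR 1); field; lra.
Qed.

(** Equivalent to (x^(-nu) t_{mu,nu})' = x^(-nu) t_{mu-1,nu+1}, with
    t_{mu-1,nu+1} expressed by t_{mu+1,nu+1} and the source term. *)
Lemma is_derive_lommel_t_raise (mu nu x : R) :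
  admissible mu nu -> 0 < x ->
  is_derive (lommel_t mu nu) x
    (nu / x * lommel_t mu nu x + lommel_t (mu + 1) (nu + 1) x + lommel_source mu nu x).
Proof.
intros HA Hx.
evar_last; [apply is_derive_lommel_t_aux; assumption|].
rewrite !lommel_tE by assumption.
assert (E := lommel_series_raise mu nu ((x / 2) ^ 2) HA).
unfold lommel_source.
replace (mu + 1 + 1) with (mu + 1 + INR 1) by (simpl; ring).
rewrite (Rpower_plus (mu + 1)), Rpower_plus, Rpower_1, Rpower_pow by lra.
replace ((x / 2) ^ 2 * PSeries (PS_derive (lommel_coef mu nu)) ((x / 2) ^ 2)) with
 ((mu - nu + 1) / 2 * lommel_coef mu nu 0
  + (x / 2) ^ 2 * lommel_series (mu + 1) (nu + 1) ((x / 2) ^ 2)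
  - (mu - nu + 1) / 2 * lommel_series mu nu ((x / 2) ^ 2)) by lra.
field; lra.
Qed.

(** * Weighted Lommel functions *)

(** The exponent [s] is independent of [nu] since both [s = nu] and
    [s = nu - 1] are needed, also for shifted indices. *)
Definition lommel_weight (beta s mu nu u : R) : R :=
  exp (- beta * u) * Rpower u s * lommel_t mu nu u.

Definition lommel_int (beta s mu nu x : R) : R :=
  RInt_gen (lommel_weight beta s mu nu) (at_right 0) (at_point x).

Lemma lommel_weight_pos (beta s mu nu x : R) :
  admissible mu nu -> 0 < x -> 0 < lommel_weight beta s mu nu x.
Proof.
intros HA Hx; apply Rmult_lt_0_compat; [|apply lommel_t_pos; assumption].
apply Rmult_lt_0_compat; apply exp_pos.
Qed.

Lemma lommel_weight_pred (beta s mu nu x : R) :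
  0 < x -> lommel_weight beta (s - 1) mu nu x = lommel_weight beta s mu nu x / x.
Proof. intros Hx; unfold lommel_weight; rewrite Rpower_pred by assumption; field; lra. Qed.

Lemma is_derive_weight (beta s x g' : R) (g : R -> R) :
  0 < x -> is_derive g x g' ->
  is_derive (fun u => exp (- beta * u) * Rpower u s * g u) x
    (exp (- beta * x) * Rpower x s * (g' + (s / x - beta) * g x)).
Proof.
intros Hx Hg.
assert (HR := is_derive_Rpower s x Hx).
auto_derive.
- repeat split; [eexists; apply HR|exists g'; apply Hg].
- replace (Derive (fun x => Rpower x s) x) with (s / x * Rpower x s)
    by (symmetry; apply is_derive_unique, HR).
  replace (Derive (fun x => g x) x) with g' by (symmetry; apply is_derive_unique, Hg).
  field; lra.
Qed.

(** What remains of the weight after factoring out the power [u^(s + mu + 1)]: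
    a continuous function on the whole line, as [ex_primitive_from_0]
    requires. *)
Definition lommel_regular_part (beta mu nu u : R) : R :=
  exp (- beta * u) * (Rpower (/ 2) (mu + 1) * lommel_series mu nu ((u / 2) ^ 2)).

Lemma lommel_weightE (beta s mu nu u : R) :
  0 < u ->
  lommel_weight beta s mu nu u = Rpower u (s + mu + 1) * lommel_regular_part beta mu nu u.
Proof.
intros Hu; unfold lommel_weight, lommel_regular_part; rewrite lommel_tE by assumption.
unfold Rdiv; rewrite <- Rpower_mult_distr by lra.
rewrite (Rplus_assoc s), (Rpower_plus s); ring.
Qed.

Lemma continuous_lommel_regular_part (beta mu nu x : R) :
  admissible mu nu -> continuous (lommel_regular_part beta mu nu) x.
Proof.
intros HA; apply (ex_derive_continuous (lommel_regular_part beta mu nu)).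
unfold lommel_regular_part; auto_derive; repeat split.
eexists; apply is_derive_lommel_series, HA.
Qed.

Lemma lommel_weight_cvg_0 (beta s mu nu : R) :
  admissible mu nu -> -1 < s + mu ->
  filterlim (lommel_weight beta s mu nu) (at_right 0) (locally 0).
Proof.
intros HA Hs.
apply filterlim_ext_loc with
  (fun u => Rpower u (s + mu + 1) * lommel_regular_part beta mu nu u).
- generalize at_right_pos; apply filter_imp; intros u Hu; symmetry.
  apply lommel_weightE, Hu.
- apply Rpower_mult_cvg_0; [lra|apply continuous_lommel_regular_part, HA].
Qed.

Lemma lommel_int_primitive (beta s mu nu : R) :
  admissible mu nu -> -2 < s + mu ->
  primitive_from_0 (lommel_weight beta s mu nu) (lommel_int beta s mu nu).
Proof.
intros HA Hs.
assert (Cg := fun x => continuous_lommel_regular_part beta mu nu x HA).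
apply primitive_RInt_gen.
- intros x Hx; apply continuous_ext_loc with
    (g := fun u => Rpower u (s + mu + 1) * lommel_regular_part beta mu nu u).
  + exists (mkposreal x Hx); intros y Hy; symmetry; apply lommel_weightE.
    change (Rabs (y - x) < x) in Hy; apply Rabs_def2 in Hy; lra.
  + apply continuous_pos_Rpower_mult; assumption.
- destruct (ex_primitive_from_0 (s + mu + 1) (lommel_regular_part beta mu nu))
    as [Phi [H1 H2]]; [lra|assumption|].
  exists Phi; split; [|assumption].
  intros x Hx; rewrite lommel_weightE by assumption; apply H1, Hx.
Qed.

Lemma lommel_int_pos (beta s mu nu x : R) :
  admissible mu nu -> -2 < s + mu -> 0 < x -> 0 < lommel_int beta s mu nu x.
Proof.
intros HA Hs Hx; destruct (lommel_int_primitive beta s mu nu HA Hs) as [H1 H2].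
apply (pos_of_derive _ _ H1 H2); [|assumption].
intros y Hy; apply lommel_weight_pos; assumption.
Qed.

Lemma lommel_source_pos (mu nu x : R) :
  0 < mu - nu + 1 -> 0 < mu + nu + 3 -> 0 < lommel_source mu nu x.
Proof.
intros Ha Hb; unfold lommel_source.
apply Rmult_lt_0_compat; [|apply Rpower_pos].
apply Rmult_lt_0_compat; [lra|].
apply lcoef_pos; simpl; lra.
Qed.

(** With p, f for the two functions and q = p - f - (nu + 1/2) f / x, the
    derivative formulas give
    q' = - (1 + 1 / (2 x)) q + (nu + 1/2) (nu + 3/2) f / x^2 + source.
    The coefficient nu + 1/2 is the largest one for which no negative multiple
    of f / x is left over. The factor exp (x) x^(1/2) absorbs the first term,
    and the rest is positive. *)
Lemma lommel_t_ratio_gt (mu nu x : R) :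
  -3 / 2 < mu -> -1 / 2 <= nu < mu + 1 -> 0 < x ->
  (1 + (nu + 1 / 2) / x) * lommel_t (mu + 1) (nu + 1) x < lommel_t mu nu x.
Proof.
intros Hmu Hnu Hx.
assert (HA : admissible mu nu) by (unfold admissible; lra).
assert (HA1 := admissible_succ _ _ HA).
pose (g := fun u => lommel_t mu nu u - lommel_t (mu + 1) (nu + 1) u
                    - (nu + 1 / 2) / u * lommel_t (mu + 1) (nu + 1) u).
pose (h := fun u => (nu + 1 / 2) * (nu + 3 / 2) / u ^ 2 * lommel_t (mu + 1) (nu + 1) u
                    + lommel_source mu nu u).
assert (Hg : forall u, 0 < u -> is_derive g u (- (1 + 1 / 2 / u) * g u + h u)).
{ intros u Hu.
  assert (Hf := is_derive_lommel_t_lower mu nu u HA Hu).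
  assert (Hp := is_derive_lommel_t_raise mu nu u HA Hu).
  unfold g, h; auto_derive.
  - repeat split; [eexists; apply Hp|eexists; apply Hf|lra|eexists; apply Hf].
  - rewrite (is_derive_unique _ _ _ Hf : Derive (fun x => lommel_t (mu + 1) (nu + 1) x) u = _).
    rewrite (is_derive_unique _ _ _ Hp : Derive (fun x => lommel_t mu nu x) u = _).
    field; lra. }
assert (H := pos_of_derive (fun u => exp (- -1 * u) * Rpower u (1 / 2) * g u)
  (fun u => exp (- -1 * u) * Rpower u (1 / 2) * h u)).
assert (Hpos : 0 < exp (- -1 * x) * Rpower x (1 / 2) * g x).
{ apply H; [| | |assumption].
  - intros u Hu; evar_last; [apply is_derive_weight; [assumption|apply Hg, Hu]|].
    cbv beta; field; lra.
  - apply filterlim_ext_loc with (fun u => lommel_weight (-1) (1 / 2) mu nu u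
      + (-1 * lommel_weight (-1) (1 / 2) (mu + 1) (nu + 1) u
      + - (nu + 1 / 2) * lommel_weight (-1) (1 / 2 - 1) (mu + 1) (nu + 1) u)).
    + generalize at_right_pos; apply filter_imp; intros u Hu.
      rewrite lommel_weight_pred by assumption.
      unfold lommel_weight, g; field; lra.
    + apply cvg_0_plus; [|apply cvg_0_plus; apply cvg_0_scal];
        apply lommel_weight_cvg_0; (assumption || lra).
  - intros u Hu; apply Rmult_lt_0_compat; [apply Rmult_lt_0_compat; apply exp_pos|].
    assert (H1 := lommel_t_pos _ _ u HA1 Hu).
    assert (H2 : 0 < lommel_source mu nu u) by (apply lommel_source_pos; lra).
    assert (0 <= (nu + 1 / 2) * (nu + 3 / 2) / u ^ 2).
    { apply Rmult_le_pos; [nra|apply Rlt_le, Rinv_0_lt_compat, pow_lt, Hu]. }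
    unfold h; nra. }
assert (He : 0 < exp (- -1 * x) * Rpower x (1 / 2)) by (apply Rmult_lt_0_compat; apply exp_pos).
assert (0 < g x).
{ apply (Rmult_lt_reg_l _ _ _ He); lra. }
unfold g in *; lra.
Qed.

Lemma lommel_t_succ_lt (mu nu x : R) :
  -3 / 2 < mu -> -1 / 2 <= nu < mu + 1 -> 0 < x ->
  lommel_t (mu + 1) (nu + 1) x < lommel_t mu nu x.
Proof.
intros Hmu Hnu Hx.
assert (H := lommel_t_ratio_gt mu nu x Hmu Hnu Hx).
assert (H1 : 0 < lommel_t (mu + 1) (nu + 1) x).
{ apply lommel_t_pos; [unfold admissible|]; lra. }
assert (0 <= (nu + 1 / 2) / x).
{ apply Rmult_le_pos; [lra|apply Rlt_le, Rinv_0_lt_compat, Hx]. }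
nra.
Qed.

Lemma is_derive_lommel_weight (beta mu nu x : R) :
  admissible mu nu -> 0 < x ->
  is_derive (lommel_weight beta nu mu nu) x
    (exp (- beta * x) * Rpower x nu *
      ((2 * nu / x - beta) * lommel_t mu nu x + lommel_t (mu + 1) (nu + 1) x
       + lommel_source mu nu x)).
Proof.
intros HA Hx; evar_last.
- apply is_derive_weight; [assumption|apply is_derive_lommel_t_raise; assumption].
- cbv beta; field; lra.
Qed.

(** The substitution [u -> beta u] in the incomplete Gamma function. *)
Lemma lommel_B_primitive (beta mu nu : R) :
  0 < beta -> 0 < mu - nu + 1 -> 0 < mu + nu + 1 ->
  primitive_from_0 (fun x => exp (- beta * x) * Rpower x nu * lommel_source mu nu x)
    (lommel_B mu nu beta).
Proof.
intros Hbeta Ha Hb.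
destruct (lower_gamma_primitive (mu + nu + 1) Hb) as [HF HF0].
pose (K := Rpower beta (- mu - nu - 1)
  / (Rpower 2 mu * Gamma ((mu - nu + 1) / 2) * Gamma ((mu + nu + 3) / 2))).
assert (HG : forall z, 0 < z -> 0 < Gamma z).
{ intros z Hz; rewrite Gamma_pos_int by assumption; apply Gamma_int_lim, Hz. }
assert (HG1 := HG ((mu - nu + 1) / 2) ltac:(lra)).
assert (HG2 := HG ((mu + nu + 3) / 2) ltac:(lra)).
assert (H2 := Rpower_pos 2 mu).
assert (E : forall x, lommel_B mu nu beta x = K * lower_gamma (mu + nu + 1) (beta * x)).
{ intros x; unfold lommel_B, K; field; lra. }
split.
- intros x Hx.
  apply is_derive_ext with (fun x => K * lower_gamma (mu + nu + 1) (beta * x)).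
  { intros; symmetry; apply E. }
  assert (HD := HF (beta * x) (Rmult_lt_0_compat _ _ Hbeta Hx)).
  auto_derive.
  { repeat split; eexists; apply HD. }
  rewrite (is_derive_unique _ _ _ HD
    : Derive (fun x => lower_gamma (mu + nu + 1) x) (beta * x) = _).
  unfold gamma_density, lommel_source, lommel_coef, lcoef, K.
  simpl (INR 0); rewrite !Rplus_0_l.
  replace ((mu - nu + 3) / 2) with ((mu - nu + 1) / 2 + 1) by field.
  rewrite <- (Rmult_assoc ((mu - nu + 1) / 2)), inv_Gamma_succ, !inv_GammaE by lra.
  replace (Rpower (x / 2) mu) with (Rpower x mu / Rpower 2 mu).
  2:{ unfold Rdiv; rewrite <- Rpower_mult_distr, <- Rpower_Ropp by lra; f_equal.
      unfold Rpower; rewrite ln_Rinv by lra; f_equal; ring. }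
  rewrite <- Rpower_mult_distr by lra.
  replace (mu + nu + 1 - 1) with (nu + mu) by ring.
  replace (- mu - nu - 1) with (- (nu + mu + 1)) by ring.
  rewrite Rpower_Ropp, !Rpower_plus, (Rpower_1 beta) by assumption.
  replace (- (beta * x)) with (- beta * x) by ring.
  assert (Hp := Rpower_pos beta mu); assert (Hq := Rpower_pos beta nu).
  field; lra.
- apply filterlim_ext with (fun x => K * lower_gamma (mu + nu + 1) (beta * x)).
  { intros; symmetry; apply E. }
  apply cvg_0_scal.
  apply (filterlim_comp _ _ _ (Rmult beta) (lower_gamma (mu + nu + 1)) _ (at_right 0));
    [|assumption].
  intros P [d Hd].
  assert (Hdb : 0 < d / beta) by (apply Rdiv_lt_0_compat; [apply cond_pos|assumption]).
  exists (mkposreal _ Hdb); intros y Hy Hy0; apply Hd.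
  + change (Rabs (y - 0) < d / beta) in Hy; change (Rabs (beta * y - 0) < d).
    rewrite Rminus_0_r in Hy |- *; rewrite Rabs_mult, (Rabs_pos_eq beta) by lra.
    apply (Rmult_lt_compat_l beta) in Hy; [|assumption].
    replace (beta * (d / beta)) with (pos d) in Hy by (field; lra); assumption.
  + apply Rmult_lt_0_compat; assumption.
Qed.

(** * The inequalities *)

Lemma Rdiv_nonneg (a x : R) : 0 <= a -> 0 < x -> 0 <= a / x.
Proof. intros Ha Hx; apply Rmult_le_pos; [assumption|apply Rlt_le, Rinv_0_lt_compat, Hx]. Qed.

Lemma exp_Rpower_pos (beta s x : R) : 0 < exp (- beta * x) * Rpower x s.
Proof. apply Rmult_lt_0_compat; apply exp_pos. Qed.

(** The functions for [nu] and [- nu] coincide, so that their common derivative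
    has two expressions. Equating them replaces t_{mu+1,nu+1} by
    t_{mu+1,1-nu} up to a difference of source terms of the right sign, and
    for the index [- nu >= 0] the functions decrease under the shift. *)
Lemma lommel_t_nonpos_gt (mu nu x : R) :
  -1 < mu -> - mu - 1 < nu <= 0 -> 0 < x ->
  lommel_t (mu + 1) (nu + 1) x < (1 - 2 * nu / x) * lommel_t mu nu x.
Proof.
intros Hmu Hnu Hx.
assert (HA : admissible mu nu) by (unfold admissible; lra).
assert (HA' : admissible mu (- nu)) by (unfold admissible; lra).
assert (E := is_derive_unique _ _ _ (is_derive_lommel_t_raise mu nu x HA Hx)).
assert (H := is_derive_lommel_t_raise mu (- nu) x HA' Hx).
apply (is_derive_ext _ (lommel_t mu nu)) in H; [|intros; apply lommel_t_opp].
apply is_derive_unique in H; rewrite E, lommel_t_opp in H; clear E.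
assert (H1 : lommel_source mu (- nu) x <= lommel_source mu nu x).
{ unfold lommel_source, lommel_coef, lcoef.
  replace (mu - - nu) with (mu + nu) by ring.
  replace (mu + - nu) with (mu - nu) by ring.
  apply Rmult_le_compat_r; [apply Rlt_le, Rpower_pos|].
  rewrite (Rmult_comm (inv_Gamma (_ + (mu + nu + 3) / 2))).
  apply Rmult_le_compat_r; [|lra].
  apply Rmult_le_pos; apply inv_Gamma_nonneg; simpl; lra. }
assert (H2 := lommel_t_succ_lt mu (- nu) x ltac:(lra) ltac:(lra) Hx).
rewrite lommel_t_opp in H2.
replace (- nu / x) with (- (nu / x)) in H by (field; lra).
replace (2 * nu / x) with (2 * (nu / x)) by (field; lra).
nra.
Qed.

(** Let w be the weight with exponent [nu - 1] and W its integral. By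
    [lommel_t_ratio_gt], w' >= ((1 - beta) + (nu - 3/2) / x) w. Hence
    (x w)' >= (nu - 1/2) w, so that W <= x w / (nu - 1/2), which is good enough
    for x <= 1 / (1 - beta). Beyond that point C w' >= w, and the inequality
    propagates: if nu < 3/2 the negative term is controlled by
    1 / x <= 1 - beta, which costs exactly the second condition on [C]. *)
Lemma lommel_int_pred_le (beta mu nu C x : R) :
  0 < beta < 1 -> - (1 / 2) < mu -> 1 / 2 < nu < mu + 1 ->
  1 <= C * (1 - beta) -> 2 <= C * (1 - beta) * (2 * nu - 1) -> 0 < x ->
  lommel_int beta (nu - 1) mu nu x <= C * lommel_weight beta (nu - 1) mu nu x.
Proof.
intros Hbeta Hmu Hnu HC1 HC2 Hx.
set (W := lommel_int beta (nu - 1) mu nu).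
set (w := lommel_weight beta (nu - 1) mu nu).
pose (P := lommel_t (mu - 1) (nu - 1)); pose (t := lommel_t mu nu).
assert (HA : admissible mu nu) by (unfold admissible; lra).
assert (HA' : admissible (mu - 1) (nu - 1)) by (unfold admissible; lra).
destruct (lommel_int_primitive beta (nu - 1) mu nu HA ltac:(lra)) as [HW HW0].
fold W w in HW, HW0.
assert (HC : 0 < C) by nra.
assert (Ht : forall u, 0 < u -> 0 < t u) by (intros; apply lommel_t_pos; assumption).
assert (HP : forall u, 0 < u -> (1 + (nu - 1 / 2) / u) * t u < P u).
{ intros u Hu.
  assert (H := lommel_t_ratio_gt (mu - 1) (nu - 1) u ltac:(lra) ltac:(lra) Hu).
  replace (mu - 1 + 1) with mu in H by ring.
  replace (nu - 1 + 1) with nu in H by ring.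
  replace (nu - 1 + 1 / 2) with (nu - 1 / 2) in H by field; exact H. }
assert (Hw : forall u, 0 < u -> is_derive w u
  (exp (- beta * u) * Rpower u (nu - 1) * (P u - (1 / u + beta) * t u))).
{ intros u Hu.
  assert (H := is_derive_lommel_t_lower (mu - 1) (nu - 1) u HA' Hu).
  replace (mu - 1 + 1) with mu in H by ring.
  replace (nu - 1 + 1) with nu in H by ring.
  evar_last; [apply is_derive_weight; [assumption|apply H]|].
  unfold P, t; field; lra. }
assert (H1 : forall u, 0 < u -> W u <= 2 / (2 * nu - 1) * (u * w u)).
{ intros u Hu.
  enough (H : 0 <= 2 / (2 * nu - 1) * (u * w u) - W u) by lra.
  apply (nonneg_of_derive (fun u => 2 / (2 * nu - 1) * (u * w u) - W u)
    (fun u => 2 / (2 * nu - 1) * (exp (- beta * u) * Rpower u (nu - 1) *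
       (t u + u * (P u - (1 / u + beta) * t u))) - w u)); [| | |assumption].
  - intros v Hv; assert (Hwv := Hw v Hv); assert (HWv := HW v Hv).
    auto_derive; [repeat split; eexists; [apply Hwv|apply HWv]|].
    rewrite (is_derive_unique _ _ _ Hwv : Derive (fun x => w x) v = _).
    rewrite (is_derive_unique _ _ _ HWv : Derive (fun x => W x) v = _).
    change (w v) with (exp (- beta * v) * Rpower v (nu - 1) * t v); field; lra.
  - apply filterlim_ext_loc with
      (fun u => 2 / (2 * nu - 1) * lommel_weight beta nu mu nu u + -1 * W u).
    + generalize at_right_pos; apply filter_imp; intros v Hv.
      unfold w; rewrite lommel_weight_pred by assumption; field; lra.
    + apply cvg_0_plus; apply cvg_0_scal; [apply lommel_weight_cvg_0|]; (assumption || lra).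
  - intros v Hv; specialize (HP v Hv); specialize (Ht v Hv).
    change (w v) with (exp (- beta * v) * Rpower v (nu - 1) * t v).
    assert (He := exp_Rpower_pos beta (nu - 1) v).
    assert (H : (nu - 1 / 2) * t v <= t v + v * (P v - (1 / v + beta) * t v)).
    { replace (t v + v * (P v - (1 / v + beta) * t v)) with (v * P v - v * beta * t v)
        by (field; lra).
      apply (Rmult_lt_compat_l v) in HP; [|assumption].
      replace (v * ((1 + (nu - 1 / 2) / v) * t v)) with (v * t v + (nu - 1 / 2) * t v) in HP
        by (field; lra).
      assert (0 <= v * (1 - beta) * t v) by (repeat apply Rmult_le_pos; lra).
      lra. }
    set (e := exp (- beta * v) * Rpower v (nu - 1)) in *.
    set (k := t v + v * (P v - (1 / v + beta) * t v)) in *.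
    replace (2 / (2 * nu - 1) * (e * k) - e * t v) with
      (2 / (2 * nu - 1) * (e * (k - (nu - 1 / 2) * t v))) by (field; lra).
    apply Rmult_le_pos; [apply Rdiv_nonneg; lra|]; apply Rmult_le_pos; lra. }
assert (H2 : forall u, 0 < u -> u <= / (1 - beta) -> W u <= C * w u).
{ intros u Hu Hub; apply Rle_trans with (1 := H1 u Hu).
  rewrite <- Rmult_assoc; apply Rmult_le_compat_r; [apply Rlt_le, lommel_weight_pos; assumption|].
  apply Rle_trans with (2 / (2 * nu - 1) * / (1 - beta)).
  - apply Rmult_le_compat_l; [apply Rdiv_nonneg|]; lra.
  - apply Rmult_le_reg_r with ((2 * nu - 1) * (1 - beta)); [apply Rmult_lt_0_compat; lra|].
    field_simplify; lra. }
assert (Hx0 : 0 < / (1 - beta)) by (apply Rinv_0_lt_compat; lra).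
destruct (Rle_dec x (/ (1 - beta))) as [Hle|Hgt]; [apply H2; assumption|].
assert (H3 := H2 _ Hx0 (Rle_refl _)).
enough (H : C * w (/ (1 - beta)) - W (/ (1 - beta)) <= C * w x - W x) by lra.
apply (nondecreasing_of_derive (fun u => C * w u - W u)
  (fun u => C * (exp (- beta * u) * Rpower u (nu - 1) * (P u - (1 / u + beta) * t u)) - w u)).
- lra.
- intros v Hv; assert (Hv0 : 0 < v) by lra.
  assert (Hwv := Hw v Hv0); assert (HWv := HW v Hv0).
  auto_derive; [repeat split; eexists; [apply Hwv|apply HWv]|].
  rewrite (is_derive_unique _ _ _ Hwv : Derive (fun x => w x) v = _).
  rewrite (is_derive_unique _ _ _ HWv : Derive (fun x => W x) v = _).
  ring.
- intros v Hv; assert (Hv0 : 0 < v) by lra.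
  specialize (HP v Hv0); specialize (Ht v Hv0).
  change (w v) with (exp (- beta * v) * Rpower v (nu - 1) * t v).
  assert (He := exp_Rpower_pos beta (nu - 1) v).
  set (e := exp (- beta * v) * Rpower v (nu - 1)) in *.
  assert (Hinv : / v <= 1 - beta).
  { rewrite <- (Rinv_inv (1 - beta)); apply Rinv_le_contravar; lra. }
  assert (Hinv0 := Rinv_0_lt_compat v Hv0).
  assert (H : 1 <= C * (1 - beta + (nu - 3 / 2) * / v)).
  { destruct (Rle_dec (3 / 2) nu).
    - assert (0 <= C * ((nu - 3 / 2) * / v)) by (repeat apply Rmult_le_pos; lra); lra.
    - assert (0 <= C * ((3 / 2 - nu) * (1 - beta - / v))) by (repeat apply Rmult_le_pos; lra).
      nra. }
  assert (Hk : (1 - beta + (nu - 3 / 2) * / v) * t v <= P v - (1 / v + beta) * t v).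
  { unfold Rdiv in *; nra. }
  assert (t v <= C * (P v - (1 / v + beta) * t v)).
  { apply (Rmult_le_compat_l C) in Hk; [|lra].
    apply (Rmult_le_compat_r (t v)) in H; lra. }
  replace (C * (e * (P v - (1 / v + beta) * t v)) - e * t v)
    with (e * (C * (P v - (1 / v + beta) * t v) - t v)) by ring.
  apply Rmult_le_pos; lra.
Qed.

(** Its positivity is the bound without a correction of order 1 / x. *)
Definition lommel_excess (beta mu nu x : R) : R :=
  (1 - beta) * lommel_int beta nu mu nu x - lommel_weight beta nu mu nu x
  + lommel_B mu nu beta x.

(** In the derivative, the multiples of beta cancel between the integral and the
    weight, and the source term cancels between the weight and [lommel_B]. *)
Lemma lommel_excess_primitive (beta mu nu : R) :
  0 < beta -> 0 < mu - nu + 1 -> 0 < mu + nu + 1 ->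
  primitive_from_0
    (fun x => exp (- beta * x) * Rpower x nu *
       ((1 - 2 * nu / x) * lommel_t mu nu x - lommel_t (mu + 1) (nu + 1) x))
    (lommel_excess beta mu nu).
Proof.
intros Hbeta Ha Hb.
assert (HA : admissible mu nu) by (unfold admissible; lra).
destruct (lommel_int_primitive beta nu mu nu HA ltac:(lra)) as [HI HI0].
destruct (lommel_B_primitive beta mu nu) as [HB HB0]; [lra..|].
split.
- intros x Hx; specialize (HI x Hx); specialize (HB x Hx).
  assert (HT := is_derive_lommel_weight beta mu nu x HA Hx).
  unfold lommel_excess; auto_derive.
  { repeat split; eexists; [apply HI|apply HT|apply HB]. }
  rewrite (is_derive_unique _ _ _ HI : Derive (fun x => lommel_int beta nu mu nu x) x = _).
  rewrite (is_derive_unique _ _ _ HT : Derive (fun x => lommel_weight beta nu mu nu x) x = _).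
  rewrite (is_derive_unique _ _ _ HB : Derive (fun x => lommel_B mu nu beta x) x = _).
  unfold lommel_weight; field; lra.
- apply filterlim_ext with (fun x => (1 - beta) * lommel_int beta nu mu nu x
    + -1 * lommel_weight beta nu mu nu x + lommel_B mu nu beta x).
  { intros; unfold lommel_excess; ring. }
  apply cvg_0_plus; [apply cvg_0_plus; apply cvg_0_scal|]; try assumption.
  apply lommel_weight_cvg_0; [assumption|lra].
Qed.

Lemma lommel_excess_pos (beta mu nu x : R) :
  0 < beta -> -1 < mu -> - mu - 1 < nu <= 0 -> 0 < x ->
  0 < lommel_excess beta mu nu x.
Proof.
intros Hbeta Hmu Hnu.
destruct (lommel_excess_primitive beta mu nu) as [HE HE0]; [lra..|].
revert x; apply (pos_of_derive _ _ HE HE0).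
intros x Hx; apply Rmult_lt_0_compat; [apply exp_Rpower_pos|].
generalize (lommel_t_nonpos_gt mu nu x Hmu Hnu Hx); lra.
Qed.

(** Adding 2 nu times the integral of the weight with exponent [nu - 1] cancels
    the term - (2 nu / x) p of the derivative; this integral is then traded for
    its bound. *)
Lemma lommel_excess_gt (beta mu nu C x : R) :
  0 < beta < 1 -> - (1 / 2) < mu -> 1 / 2 < nu < mu + 1 ->
  1 <= C * (1 - beta) -> 2 <= C * (1 - beta) * (2 * nu - 1) -> 0 < x ->
  - (2 * nu * C / x * lommel_weight beta nu mu nu x) < lommel_excess beta mu nu x.
Proof.
intros Hbeta Hmu Hnu HC1 HC2 Hx.
assert (HA : admissible mu nu) by (unfold admissible; lra).
destruct (lommel_excess_primitive beta mu nu) as [HE HE0]; [lra..|].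
destruct (lommel_int_primitive beta (nu - 1) mu nu HA ltac:(lra)) as [HW HW0].
assert (HWx := lommel_int_pred_le beta mu nu C x Hbeta Hmu Hnu HC1 HC2 Hx).
rewrite lommel_weight_pred in HWx by assumption.
apply (Rmult_le_compat_l (2 * nu)) in HWx; [|lra].
enough (H : 0 < lommel_excess beta mu nu x + 2 * nu * lommel_int beta (nu - 1) mu nu x).
{ replace (2 * nu * (C * (lommel_weight beta nu mu nu x / x)))
    with (2 * nu * C / x * lommel_weight beta nu mu nu x) in HWx by (field; lra).
  lra. }
apply (pos_of_derive
  (fun x => lommel_excess beta mu nu x + 2 * nu * lommel_int beta (nu - 1) mu nu x)
  (fun x => exp (- beta * x) * Rpower x nu *
     (lommel_t mu nu x - lommel_t (mu + 1) (nu + 1) x))); [| | |assumption].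
- intros u Hu; specialize (HE u Hu); specialize (HW u Hu).
  auto_derive; [repeat split; eexists; [apply HE|apply HW]|].
  rewrite (is_derive_unique _ _ _ HE : Derive (fun x => lommel_excess beta mu nu x) u = _).
  rewrite (is_derive_unique _ _ _ HW
    : Derive (fun x => lommel_int beta (nu - 1) mu nu x) u = _).
  rewrite lommel_weight_pred by assumption; unfold lommel_weight; field; lra.
- apply cvg_0_plus; [|apply cvg_0_scal]; assumption.
- intros u Hu; apply Rmult_lt_0_compat; [apply exp_Rpower_pos|].
  generalize (lommel_t_succ_lt mu nu u ltac:(lra) ltac:(lra) Hu); lra.
Qed.

Lemma admissible_add (mu nu : R) (k : nat) :
  admissible mu nu -> admissible (mu + INR k) (nu + INR k).
Proof. unfold admissible; generalize (pos_INR k); lra. Qed.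

(** The difference of the two sides has derivative
    exp (- beta x) x^nu (k / x) t_{mu+k+1,nu+k+1} >= 0. Subtracting the last
    integral is possible for every k, and its instance k = 0 makes the
    final inequality strict. *)
Lemma lommel_weight_succ_le (beta mu nu x : R) (k : nat) :
  admissible mu nu -> -2 < mu + nu -> 0 < x ->
  lommel_weight beta nu (mu + INR k + 1) (nu + INR k + 1) x
  <= lommel_int beta nu (mu + INR k) (nu + INR k) x
     - beta * lommel_int beta nu (mu + INR k + 1) (nu + INR k + 1) x
     - lommel_int beta (nu - 1) (mu + INR k + 1) (nu + INR k + 1) x.
Proof.
intros HA0 Hs Hx.
assert (Hk := pos_INR k).
assert (HA := admissible_add mu nu k HA0).
assert (HA1 := admissible_succ _ _ HA).
set (m := mu + INR k) in *; set (n := nu + INR k) in *.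
assert (Hm : mu <= m) by (unfold m; lra).
destruct (lommel_int_primitive beta nu m n HA ltac:(lra)) as [HJ HJ0].
destruct (lommel_int_primitive beta nu (m + 1) (n + 1) HA1 ltac:(lra)) as [HK HK0].
destruct (lommel_int_primitive beta (nu - 1) (m + 1) (n + 1) HA1 ltac:(lra)) as [HW HW0].
enough (H : 0 <= lommel_int beta nu m n x - beta * lommel_int beta nu (m + 1) (n + 1) x
  - lommel_int beta (nu - 1) (m + 1) (n + 1) x - lommel_weight beta nu (m + 1) (n + 1) x) by lra.
revert x Hx; apply (nonneg_of_derive
  (fun x => lommel_int beta nu m n x - beta * lommel_int beta nu (m + 1) (n + 1) x
  - lommel_int beta (nu - 1) (m + 1) (n + 1) x - lommel_weight beta nu (m + 1) (n + 1) x)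
  (fun x => exp (- beta * x) * Rpower x nu * (INR k / x * lommel_t (m + 1) (n + 1) x))).
- intros u Hu; specialize (HJ u Hu); specialize (HK u Hu); specialize (HW u Hu).
  assert (HT := is_derive_weight beta nu u _ _ Hu (is_derive_lommel_t_lower m n u HA Hu)).
  cbv beta in HT.
  auto_derive; [repeat split; eexists; [apply HJ|apply HK|apply HW|apply HT]|].
  rewrite (is_derive_unique _ _ _ HJ : Derive (fun x => lommel_int beta nu m n x) u = _).
  rewrite (is_derive_unique _ _ _ HK
    : Derive (fun x => lommel_int beta nu (m + 1) (n + 1) x) u = _).
  rewrite (is_derive_unique _ _ _ HW
    : Derive (fun x => lommel_int beta (nu - 1) (m + 1) (n + 1) x) u = _).
  rewrite (is_derive_unique _ _ _ HT
    : Derive (fun x => lommel_weight beta nu (m + 1) (n + 1) x) u = _).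
  rewrite lommel_weight_pred by assumption; unfold lommel_weight, n; field; lra.
- apply filterlim_ext with (fun x => lommel_int beta nu m n x
    + (- beta * lommel_int beta nu (m + 1) (n + 1) x
    + (-1 * lommel_int beta (nu - 1) (m + 1) (n + 1) x
    + -1 * lommel_weight beta nu (m + 1) (n + 1) x))); [intros; ring|].
  repeat (apply cvg_0_plus || apply cvg_0_scal); try assumption.
  apply lommel_weight_cvg_0; [assumption|lra].
- intros u Hu; apply Rmult_le_pos; [apply Rlt_le, exp_Rpower_pos|].
  apply Rmult_le_pos; [apply Rdiv_nonneg; assumption|].
  apply Rlt_le, lommel_t_pos; assumption.
Qed.

(** The first two integrals of [lommel_weight_succ_le] telescope. *)
Lemma sum_lommel_weight_le_rest (beta mu nu x : R) (N : nat) :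
  0 < beta -> admissible mu nu -> -2 < mu + nu -> 0 < x ->
  sum_n (fun k => beta ^ k * lommel_weight beta nu (mu + INR k + 1) (nu + INR k + 1) x) N
  <= lommel_int beta nu mu nu x - lommel_int beta (nu - 1) (mu + 1) (nu + 1) x
     - beta ^ S N * lommel_int beta nu (mu + INR N + 1) (nu + INR N + 1) x.
Proof.
intros Hbeta HA Hs Hx; induction N as [|N IH].
- rewrite sum_O; generalize (lommel_weight_succ_le beta mu nu x 0 HA Hs Hx).
  simpl (INR 0); rewrite !Rplus_0_r; simpl; lra.
- rewrite sum_Sn; change plus with Rplus.
  assert (H := lommel_weight_succ_le beta mu nu x (S N) HA Hs Hx).
  assert (Hp : 0 <= beta ^ S N) by (apply pow_le; lra).
  apply (Rmult_le_compat_l _ _ _ Hp) in H.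
  assert (HW : 0 <= beta ^ S N
    * lommel_int beta (nu - 1) (mu + INR (S N) + 1) (nu + INR (S N) + 1) x).
  { apply Rmult_le_pos; [assumption|apply Rlt_le, lommel_int_pos; [|rewrite S_INR|assumption]].
    - apply admissible_succ, admissible_add, HA.
    - generalize (pos_INR N); lra. }
  rewrite S_INR in *; rewrite <- !(Rplus_assoc _ (INR N) 1) in *.
  change (beta ^ S (S N)) with (beta * beta ^ S N).
  rewrite !Rmult_minus_distr_l in H; lra.
Qed.

Lemma sum_lommel_weight_le (beta mu nu x : R) (N : nat) :
  0 < beta -> admissible mu nu -> -2 < mu + nu -> 0 < x ->
  sum_n (fun k => beta ^ k * lommel_weight beta nu (mu + INR k + 1) (nu + INR k + 1) x) N
  <= lommel_int beta nu mu nu x - lommel_int beta (nu - 1) (mu + 1) (nu + 1) x.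
Proof.
intros Hbeta HA Hs Hx.
assert (H := sum_lommel_weight_le_rest beta mu nu x N Hbeta HA Hs Hx).
assert (0 <= beta ^ S N * lommel_int beta nu (mu + INR N + 1) (nu + INR N + 1) x).
{ apply Rmult_le_pos; [apply pow_le; lra|apply Rlt_le, lommel_int_pos; [| |assumption]].
  - apply admissible_succ, admissible_add, HA.
  - generalize (pos_INR N); lra. }
lra.
Qed.

Definition lommel_sum (beta mu nu x : R) : R :=
  Series (fun k => beta ^ k * lommel_t (mu + INR k + 1) (nu + INR k + 1) x).

(** The terms are nonnegative and the partial sums bounded, whence convergence
    together with the bound. *)
Lemma lommel_sum_le (beta mu nu x : R) :
  0 < beta -> admissible mu nu -> -2 < mu + nu -> 0 < x ->
  ex_series (fun k => beta ^ k * lommel_t (mu + INR k + 1) (nu + INR k + 1) x) /\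
  exp (- beta * x) * Rpower x nu * lommel_sum beta mu nu x
  <= lommel_int beta nu mu nu x - lommel_int beta (nu - 1) (mu + 1) (nu + 1) x.
Proof.
intros Hbeta HA Hs Hx.
set (e := exp (- beta * x) * Rpower x nu).
assert (He : 0 < e) by apply exp_Rpower_pos.
set (M := lommel_int beta nu mu nu x - lommel_int beta (nu - 1) (mu + 1) (nu + 1) x).
set (c := fun k => beta ^ k * lommel_t (mu + INR k + 1) (nu + INR k + 1) x).
assert (Hc : forall k, 0 <= c k).
{ intros k; apply Rmult_le_pos; [apply pow_le; lra|].
  apply Rlt_le, lommel_t_pos; [apply admissible_succ, admissible_add, HA|assumption]. }
assert (Hsum : forall N, sum_n c N <= M / e).
{ intros N; apply Rmult_le_reg_l with e; [assumption|].
  replace (e * (M / e)) with M by (field; lra).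
  apply Rle_trans with (2 := sum_lommel_weight_le beta mu nu x N Hbeta HA Hs Hx).
  right; transitivity (sum_n (fun k => e * c k) N).
  - symmetry; apply (sum_n_mult_l (K := R_Ring) e c N).
  - apply sum_n_ext; intros k.
    enough (E : e * c k
      = beta ^ k * lommel_weight beta nu (mu + INR k + 1) (nu + INR k + 1) x) by exact E.
    unfold c, lommel_weight, e; ring. }
destruct (ex_finite_lim_seq_incr (sum_n c) (M / e)) as [l Hl].
- intros n; rewrite sum_Sn; change plus with Rplus; generalize (Hc (S n)); lra.
- assumption.
- assert (Hser : is_series c l) by exact Hl.
  split; [exists l; exact Hser|].
  unfold lommel_sum; fold c; rewrite (is_series_unique _ _ Hser).
  assert (H := is_lim_seq_le _ _ _ _ Hsum Hl (is_lim_seq_const (M / e))).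
  simpl in H; apply (Rmult_le_compat_l e) in H; [|lra].
  replace (e * (M / e)) with M in H by (field; lra); exact H.
Qed.

Lemma lommel_sum_lt (beta mu nu x : R) :
  0 < beta -> admissible mu nu -> -2 < mu + nu -> 0 < x ->
  exp (- beta * x) * Rpower x nu * lommel_sum beta mu nu x < lommel_int beta nu mu nu x.
Proof.
intros Hbeta HA Hs Hx.
destruct (lommel_sum_le beta mu nu x Hbeta HA Hs Hx) as [_ H].
assert (0 < lommel_int beta (nu - 1) (mu + 1) (nu + 1) x).
{ apply lommel_int_pos; [apply admissible_succ, HA|lra|assumption]. }
lra.
Qed.

(** * Behaviour at infinity *)

(** The explicit rate O(1/x), rather than mere convergence, is what
    [comparison_of_log_derivative] needs for the logarithmic derivative. *)
Definition decays (g : R -> R) : Prop :=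
  exists K X, 1 <= X /\ forall x, X <= x -> Rabs (g x) <= K / x.

Lemma decays_is_lim (g : R -> R) (l : R) :
  decays (fun x => g x - l) -> is_lim g p_infty l.
Proof.
intros [K [X [HX H]]].
apply is_lim_spec; intros eps.
assert (He := cond_pos eps).
exists (Rmax X (Rabs K / eps)); intros x Hx.
assert (Hx1 := Rle_lt_trans _ _ _ (Rmax_l _ _) Hx).
assert (Hx2 := Rle_lt_trans _ _ _ (Rmax_r _ _) Hx).
apply Rle_lt_trans with (1 := H x (Rlt_le _ _ Hx1)).
apply Rle_lt_trans with (Rabs K / x).
- apply Rmult_le_compat_r; [apply Rlt_le, Rinv_0_lt_compat; lra|apply Rle_abs].
- apply Rmult_lt_reg_r with x; [lra|].
  apply (Rmult_lt_compat_r eps) in Hx2; [|assumption].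
  replace (Rabs K / eps * eps) with (Rabs K) in Hx2 by (field; lra).
  replace (Rabs K / x * x) with (Rabs K) by (field; lra); lra.
Qed.

(** The function exp (2 x) (K / x - r) is nondecreasing once K >= M, because
    2 K / x - K / x^2 >= K / x for x >= 1; the choice K >= |r 1| makes it
    nonnegative at 1. *)
Lemma relaxation_le (r E : R -> R) (M : R) :
  (forall x, 1 <= x -> is_derive r x (- 2 * r x + E x)) ->
  (forall x, 1 <= x -> E x <= M / x) ->
  forall x, 1 <= x -> r x <= Rmax (Rabs (r 1)) M / x.
Proof.
intros Hr HE x Hx.
set (K := Rmax (Rabs (r 1)) M).
assert (HK1 : r 1 <= K) by apply (Rle_trans _ _ _ (Rle_abs _) (Rmax_l _ _)).
assert (HK0 : 0 <= K) by apply (Rle_trans _ _ _ (Rabs_pos _) (Rmax_l _ _)).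
assert (HKM : M <= K) by apply Rmax_r.
assert (H : exp (2 * 1) * (K / 1 - r 1) <= exp (2 * x) * (K / x - r x)).
{ apply (nondecreasing_of_derive (fun x => exp (2 * x) * (K / x - r x))
    (fun x => exp (2 * x) * (2 * K / x - K / x ^ 2 - E x))); [assumption| |].
  - intros u Hu; assert (Hru := Hr u (proj1 Hu)).
    auto_derive; [split; [lra|split; [eexists; apply Hru|exact I]]|].
    rewrite (is_derive_unique _ _ _ Hru : Derive (fun x => r x) u = _).
    field; lra.
  - intros u Hu; apply Rmult_le_pos; [apply Rlt_le, exp_pos|].
    assert (H1 := HE u (proj1 Hu)).
    assert (H2 : 0 < / u <= 1).
    { split; [apply Rinv_0_lt_compat; lra|rewrite <- Rinv_1; apply Rinv_le_contravar; lra]. }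
    replace (2 * K / u - K / u ^ 2) with (K * / u + K * (/ u * (1 - / u))) by (field; lra).
    assert (0 <= K * (/ u * (1 - / u))) by (repeat apply Rmult_le_pos; lra).
    unfold Rdiv in H1; nra. }
assert (Hp := exp_pos (2 * x)).
assert (0 <= exp (2 * 1) * (K / 1 - r 1)) by (apply Rmult_le_pos; [apply Rlt_le, exp_pos|lra]).
apply Rnot_lt_le; intros Hlt; nra.
Qed.

Lemma relaxation_decays (r E : R -> R) (M : R) :
  (forall x, 1 <= x -> is_derive r x (- 2 * r x + E x)) ->
  (forall x, 1 <= x -> Rabs (E x) <= M / x) ->
  decays r.
Proof.
intros Hr HE.
exists (Rmax (Rabs (r 1)) M), 1; split; [lra|intros x Hx]; apply Rabs_le; split.
- enough (H : - r x <= Rmax (Rabs (- r 1)) M / x) by (rewrite Rabs_Ropp in H; lra).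
  apply (relaxation_le (fun x => - r x) (fun x => - E x)); [| |assumption].
  + intros u Hu; evar_last; [apply (is_derive_opp r u), Hr, Hu|].
    unfold opp; simpl; ring.
  + intros u Hu; apply Rle_trans with (2 := HE u Hu); rewrite <- Rabs_Ropp; apply Rle_abs.
- apply (relaxation_le r E); [assumption| |assumption].
  intros u Hu; apply Rle_trans with (2 := HE u Hu), Rle_abs.
Qed.

(** The source is of order x^mu, whereas t_{mu,nu} contains a positive multiple
    of x^(mu + 3). *)
Lemma lommel_source_le (mu nu : R) :
  admissible mu nu ->
  exists C, 0 <= C /\ forall x, 1 <= x -> Rabs (lommel_source mu nu x) <= C / x * lommel_t mu nu x.
Proof.
intros HA; destruct (lommel_t_ge mu nu HA) as [c [Hc Hge]].
unfold lommel_source; set (al := (mu - nu + 1) / 2 * lommel_coef mu nu 0).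
assert (Hal := Rabs_pos al).
exists (8 * Rabs al / c); split; [apply Rdiv_nonneg; lra|].
intros x Hx; rewrite Rabs_mult, (Rabs_pos_eq (Rpower _ _)) by apply Rlt_le, Rpower_pos.
apply Rle_trans with (8 * Rabs al / c / x * (c * Rpower (x / 2) (mu + 3))).
- replace (mu + 3) with (mu + INR 3) by (simpl; ring).
  rewrite Rpower_plus, Rpower_pow by lra.
  assert (Hp := Rpower_pos (x / 2) mu).
  replace (8 * Rabs al / c / x * (c * (Rpower (x / 2) mu * (x / 2) ^ 3)))
    with (Rabs al * Rpower (x / 2) mu * x ^ 2) by (field; lra).
  assert (0 <= Rabs al * Rpower (x / 2) mu) by nra.
  assert (1 <= x ^ 2) by nra.
  nra.
- apply Rmult_le_compat_l; [|apply Hge; lra].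
  apply Rdiv_nonneg; [apply Rdiv_nonneg|]; lra.
Qed.

Lemma Rabs_div_le (a b k : R) : 0 < b -> Rabs a <= k * b -> Rabs (a / b) <= k.
Proof.
intros Hb H; unfold Rdiv; rewrite Rabs_mult, (Rabs_pos_eq (/ b))
  by apply Rlt_le, Rinv_0_lt_compat, Hb.
apply Rmult_le_reg_r with b; [assumption|].
rewrite Rmult_assoc, Rinv_l, Rmult_1_r by lra; assumption.
Qed.

(** The system for (p, f) tends to p' = f, f' = p. In it p + f grows like
    exp (x) and p - f decays like exp (- x), so that
    r = (p - f) / (p + f) solves r' = - 2 r up to an error which is O(1/x)
    because |r| <= 1. *)
Lemma lommel_t_ratio_decays (mu nu : R) :
  admissible mu nu ->
  decays (fun x => lommel_t (mu + 1) (nu + 1) x / lommel_t mu nu x - 1).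
Proof.
intros HA; assert (HA1 := admissible_succ _ _ HA).
destruct (lommel_source_le mu nu HA) as [C [HC Ha]].
set (p := lommel_t mu nu); set (f := lommel_t (mu + 1) (nu + 1)).
set (a := lommel_source mu nu) in *.
assert (Hp : forall x, 1 <= x -> 0 < p x) by (intros; apply lommel_t_pos; [assumption|lra]).
assert (Hf : forall x, 1 <= x -> 0 < f x) by (intros; apply lommel_t_pos; [assumption|lra]).
pose (r := fun x => (p x - f x) / (p x + f x)).
pose (U := fun x => (nu * p x + (nu + 1) * f x) / x + a x).
pose (V := fun x => (nu * p x - (nu + 1) * f x) / x + a x).
assert (Hr1 : forall x, 1 <= x -> Rabs (r x) <= 1).
{ intros x Hx; specialize (Hp x Hx); specialize (Hf x Hx).
  apply Rabs_div_le; [lra|apply Rabs_le; lra]. }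
destruct (relaxation_decays r (fun x => (U x - r x * V x) / (p x + f x))
  (2 * (Rabs nu + Rabs (nu + 1) + C))) as [K [X [HX HK]]].
- intros x Hx; assert (Hx0 : 0 < x) by lra.
  assert (Dp := is_derive_lommel_t_raise mu nu x HA Hx0).
  assert (Df := is_derive_lommel_t_lower mu nu x HA Hx0).
  specialize (Hp x Hx); specialize (Hf x Hx).
  fold p f a in Dp, Df.
  unfold r at 1; auto_derive.
  + repeat split; [eexists; apply Dp|eexists; apply Df|eexists; apply Dp|eexists; apply Df|lra].
  (* U and V collect the lower order terms of p' - f' and p' + f'. *)
  + rewrite (is_derive_unique _ _ _ Dp : Derive (fun x => p x) x = _).
    rewrite (is_derive_unique _ _ _ Df : Derive (fun x => f x) x = _).
    unfold r, U, V; field; lra.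
- intros x Hx; specialize (Hp x Hx); specialize (Hf x Hx); specialize (Hr1 x Hx).
  specialize (Ha x Hx).
  assert (Hx0 : 0 < / x) by (apply Rinv_0_lt_compat; lra).
  assert (Hn := Rabs_pos nu); assert (Hn1 := Rabs_pos (nu + 1)).
  set (L := Rabs nu + Rabs (nu + 1) + C).
  assert (HaS : Rabs (a x) <= C / x * (p x + f x)).
  { apply Rle_trans with (1 := Ha), Rmult_le_compat_l; [apply Rdiv_nonneg|]; fold p; lra. }
  assert (Hlin : forall s, Rabs s <= Rabs (nu + 1) ->
    Rabs ((nu * p x + s * f x) / x + a x) <= L / x * (p x + f x)).
  { intros s Hs.
    apply Rle_trans with (1 := Rabs_triang _ _).
    replace (L / x * (p x + f x)) with
      ((Rabs nu + Rabs (nu + 1)) * (p x + f x) * / x + C / x * (p x + f x))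
      by (unfold L; field; lra).
    apply Rplus_le_compat; [|assumption].
    unfold Rdiv; rewrite Rabs_mult, (Rabs_pos_eq (/ x)) by lra.
    apply Rmult_le_compat_r; [lra|].
    apply Rle_trans with (1 := Rabs_triang _ _).
    rewrite !Rabs_mult, (Rabs_pos_eq (p x)), (Rabs_pos_eq (f x)) by lra; nra. }
  assert (HU : Rabs (U x) <= L / x * (p x + f x)) by (apply Hlin; lra).
  assert (HV : Rabs (V x) <= L / x * (p x + f x)).
  { unfold V; replace (nu * p x - (nu + 1) * f x) with (nu * p x + - (nu + 1) * f x) by ring.
    apply Hlin; rewrite Rabs_Ropp; lra. }
  apply Rabs_div_le; [lra|].
  unfold Rminus; apply Rle_trans with (1 := Rabs_triang _ _); rewrite Rabs_Ropp, Rabs_mult.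
  replace (2 * L / x * (p x + f x)) with (L / x * (p x + f x) + L / x * (p x + f x))
    by (field; lra).
  apply Rplus_le_compat; [assumption|].
  assert (H0 := Rabs_pos (V x)); nra.
- exists (4 * K), (Rmax X (2 * K)); split.
  { apply Rle_trans with (1 := HX), Rmax_l. }
  intros x Hx.
  assert (HxX := Rle_trans _ _ _ (Rmax_l _ _) Hx).
  assert (HxK := Rle_trans _ _ _ (Rmax_r _ _) Hx).
  assert (Hx1 : 1 <= x) by lra.
  specialize (Hp x Hx1); specialize (Hf x Hx1); specialize (HK x HxX).
  (* For x >= 2 K the bound on r also gives f <= 3 p, so that dividing by p
     instead of p + f costs a factor 4. *)
  assert (HKx : K / x <= / 2).
  { apply Rmult_le_reg_r with x; [lra|]; unfold Rdiv; rewrite Rmult_assoc, Rinv_l; lra. }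
  assert (Hd : Rabs (p x - f x) <= K / x * (p x + f x)).
  { replace (p x - f x) with (r x * (p x + f x)) by (unfold r; field; lra).
    rewrite Rabs_mult, (Rabs_pos_eq (p x + f x)) by lra.
    apply Rmult_le_compat_r; lra. }
  assert (HK0 : 0 <= K / x) by (apply Rle_trans with (2 := HK), Rabs_pos).
  assert (Hf3 : f x <= 3 * p x).
  { rewrite Rabs_minus_sym in Hd; assert (H := Rle_trans _ _ _ (Rle_abs _) Hd); nra. }
  replace (f x / p x - 1) with (- (p x - f x) / p x) by (field; lra).
  apply Rabs_div_le; [assumption|]; rewrite Rabs_Ropp.
  apply Rle_trans with (1 := Hd).
  replace (4 * K / x * p x) with (K / x * (4 * p x)) by (field; lra).
  apply Rmult_le_compat_l; lra.
Qed.

(** A form of l'Hopital's rule with a rate. The derivative of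
    (h0 / lam + K / x) T - H is at least
    (T / x) (K lam - K (M + 1) / x - |h0| M / lam - C). It is nonnegative if
    x >= 2 (M + 1) / lam and K is large; a possibly larger K makes the function
    itself nonnegative at the starting point. *)
Lemma comparison_of_log_derivative (T dT H h : R -> R) (lam M X h0 C : R) :
  0 < lam -> 0 < X ->
  (forall x, X <= x -> 0 < T x) ->
  (forall x, X <= x -> is_derive T x (dT x)) ->
  (forall x, X <= x -> Rabs (dT x - lam * T x) <= M / x * T x) ->
  (forall x, X <= x -> is_derive H x (h x)) ->
  (forall x, X <= x -> h x <= (h0 + C / x) * T x) ->
  exists K X', X <= X' /\ forall x, X' <= x -> H x <= (h0 / lam + K / x) * T x.
Proof.
intros Hlam HX HT DT HdT DH Hh.
pose (X' := Rmax X (2 * (M + 1) / lam)).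
pose (K1 := 2 * (Rabs h0 * M / lam + C) / lam).
pose (K2 := X' * (H X' / T X' - h0 / lam)).
pose (K := Rmax 0 (Rmax K1 K2)).
assert (HXX' : X <= X') by apply Rmax_l.
assert (HK0 : 0 <= K) by apply Rmax_l.
assert (HK1 : K1 <= K) by apply (Rle_trans _ _ _ (Rmax_l _ _) (Rmax_r _ _)).
assert (HK2 : K2 <= K) by apply (Rle_trans _ _ _ (Rmax_r _ _) (Rmax_r _ _)).
exists K, X'; split; [assumption|intros x Hx].
enough (HH : (h0 / lam + K / X') * T X' - H X' <= (h0 / lam + K / x) * T x - H x).
{ assert (HTX := HT X' HXX').
  enough (H X' <= (h0 / lam + K / X') * T X') by lra.
  replace (H X') with ((h0 / lam + K2 / X') * T X') by (unfold K2; field; lra).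
  apply Rmult_le_compat_r; [lra|]; apply Rplus_le_compat_l.
  apply Rmult_le_compat_r; [apply Rlt_le, Rinv_0_lt_compat; lra|assumption]. }
apply (nondecreasing_of_derive (fun x => (h0 / lam + K / x) * T x - H x)
  (fun x => - K / x ^ 2 * T x + (h0 / lam + K / x) * dT x - h x)); [assumption| |].
- intros u Hu; assert (HuX : X <= u) by lra.
  assert (DTu := DT u HuX); assert (DHu := DH u HuX).
  auto_derive; [repeat split; [lra|eexists; apply DTu|eexists; apply DHu]|].
  rewrite (is_derive_unique _ _ _ DTu : Derive (fun x => T x) u = _).
  rewrite (is_derive_unique _ _ _ DHu : Derive (fun x => H x) u = _).
  field; lra.
- intros u Hu; assert (HuX : X <= u) by lra.
  assert (Hu0 : 0 < / u) by (apply Rinv_0_lt_compat; lra).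
  specialize (HT u HuX); specialize (HdT u HuX); specialize (Hh u HuX).
  assert (HuM : (M + 1) * / u <= lam / 2).
  { assert (H1 : 2 * (M + 1) / lam <= u) by (apply Rle_trans with (2 := proj1 Hu), Rmax_r).
    apply (Rmult_le_compat_r (lam / 2)) in H1; [|lra].
    replace (2 * (M + 1) / lam * (lam / 2)) with (M + 1) in H1 by (field; lra).
    apply Rmult_le_reg_r with u; [lra|]; rewrite Rmult_assoc, Rinv_l; lra. }
  assert (HKl : Rabs h0 * M / lam + C <= K * (lam / 2)).
  { apply (Rmult_le_compat_r (lam / 2)) in HK1; [|lra].
    replace (K1 * (lam / 2)) with (Rabs h0 * M / lam + C) in HK1 by (unfold K1; field; lra).
    assumption. }
  assert (Hcoef : Rabs (h0 / lam + K / u) <= Rabs h0 / lam + K / u).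
  { apply Rle_trans with (1 := Rabs_triang _ _); apply Req_le; f_equal.
    - unfold Rdiv; rewrite Rabs_mult, (Rabs_pos_eq (/ lam)); [reflexivity|].
      apply Rlt_le, Rinv_0_lt_compat, Hlam.
    - apply Rabs_pos_eq, Rdiv_nonneg; lra. }
  assert (Herr : - ((Rabs h0 / lam + K / u) * (M / u * T u))
                 <= (h0 / lam + K / u) * (dT u - lam * T u)).
  { assert (H1 : Rabs ((h0 / lam + K / u) * (dT u - lam * T u))
      <= (Rabs h0 / lam + K / u) * (M / u * T u)).
    { rewrite Rabs_mult; apply Rmult_le_compat; (assumption || apply Rabs_pos). }
    rewrite <- Rabs_Ropp in H1; generalize (Rle_trans _ _ _ (Rle_abs _) H1); lra. }
  apply Rle_trans with (T u * / u *
    ((K * (lam / 2) - (Rabs h0 * M / lam + C)) + K * (lam / 2 - (M + 1) * / u))).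
  { repeat apply Rmult_le_pos; try lra.
    assert (0 <= K * (lam / 2 - (M + 1) * / u)) by (apply Rmult_le_pos; lra); lra. }
  replace (- K / u ^ 2 * T u + (h0 / lam + K / u) * dT u - h u)
    with (T u * (- K / u ^ 2 + h0 + K / u * lam)
          + (h0 / lam + K / u) * (dT u - lam * T u) - h u) by (field; lra).
  apply Rle_trans with (T u * (- K / u ^ 2 + h0 + K / u * lam)
    - (Rabs h0 / lam + K / u) * (M / u * T u) - (h0 + C / u) * T u); [|lra].
  right; field; lra.
Qed.

Lemma lommel_weight_log_derivative (beta mu nu : R) :
  admissible mu nu ->
  exists M X, 1 <= X /\ forall x, X <= x ->
    Rabs (exp (- beta * x) * Rpower x nu *
      ((2 * nu / x - beta) * lommel_t mu nu x + lommel_t (mu + 1) (nu + 1) x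
       + lommel_source mu nu x) - (1 - beta) * lommel_weight beta nu mu nu x)
    <= M / x * lommel_weight beta nu mu nu x.
Proof.
intros HA; destruct (lommel_t_ratio_decays mu nu HA) as [K [X [HX HK]]].
destruct (lommel_source_le mu nu HA) as [C [HC Ha]].
exists (2 * Rabs nu + K + C), X; split; [assumption|].
intros x Hx; assert (Hx1 : 1 <= x) by lra.
specialize (HK x Hx); specialize (Ha x Hx1).
assert (Hp : 0 < lommel_t mu nu x) by (apply lommel_t_pos; [assumption|lra]).
assert (He := exp_Rpower_pos beta nu x).
unfold lommel_weight.
set (e := exp (- beta * x) * Rpower x nu) in *.
set (p := lommel_t mu nu x) in *; set (f := lommel_t (mu + 1) (nu + 1) x) in *.
set (a := lommel_source mu nu x) in *.
replace (e * ((2 * nu / x - beta) * p + f + a) - (1 - beta) * (e * p))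
  with (e * (2 * nu / x * p + (f / p - 1) * p + a)) by (field; lra).
replace ((2 * Rabs nu + K + C) / x * (e * p))
  with (e * (2 * Rabs nu / x * p + K / x * p + C / x * p)) by (field; lra).
rewrite Rabs_mult, (Rabs_pos_eq e) by lra; apply Rmult_le_compat_l; [lra|].
apply Rle_trans with (1 := Rabs_triang _ _), Rplus_le_compat; [|assumption].
apply Rle_trans with (1 := Rabs_triang _ _); rewrite !Rabs_mult, (Rabs_pos_eq p) by lra.
apply Rplus_le_compat; apply Rmult_le_compat_r; try lra.
unfold Rdiv; rewrite !Rabs_mult, (Rabs_pos_eq 2), (Rabs_pos_eq (/ x)); [lra| |lra].
apply Rlt_le, Rinv_0_lt_compat; lra.
Qed.

Lemma lommel_weight_dominates (beta mu nu : R) (H h : R -> R) (h0 C : R) :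
  beta < 1 -> admissible mu nu ->
  (forall x, 0 < x -> is_derive H x (h x)) ->
  (forall x, 1 <= x -> h x <= (h0 + C / x) * lommel_weight beta nu mu nu x) ->
  exists K X, 1 <= X /\ forall x, X <= x ->
    H x / lommel_weight beta nu mu nu x - h0 / (1 - beta) <= K / x.
Proof.
intros Hbeta HA DH Hh.
destruct (lommel_weight_log_derivative beta mu nu HA) as [M [X [HX HT]]].
destruct (comparison_of_log_derivative (lommel_weight beta nu mu nu)
  (fun x => exp (- beta * x) * Rpower x nu *
      ((2 * nu / x - beta) * lommel_t mu nu x + lommel_t (mu + 1) (nu + 1) x
       + lommel_source mu nu x)) H h (1 - beta) M X h0 C)
  as [K [X' [HXX' HK]]]; [lra|lra| | |exact HT| | |].
- intros x Hx; apply lommel_weight_pos; [assumption|lra].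
- intros x Hx; apply is_derive_lommel_weight; [assumption|lra].
- intros x Hx; apply DH; lra.
- intros x Hx; apply Hh; lra.
- exists K, X'; split; [lra|].
  intros x Hx; specialize (HK x Hx).
  assert (Hw := lommel_weight_pos beta nu mu nu x HA ltac:(lra)).
  apply Rmult_le_reg_r with (1 := Hw).
  apply Rle_trans with ((h0 / (1 - beta) + K / x) * lommel_weight beta nu mu nu x
    - h0 / (1 - beta) * lommel_weight beta nu mu nu x); [|lra].
  rewrite Rmult_minus_distr_r; apply Rplus_le_compat_r.
  apply Rle_trans with (2 := HK); right; field; lra.
Qed.

(** Upper and lower bounds come from [lommel_weight_dominates] applied to the
    integral and to its opposite. *)
Lemma lommel_int_asymptotics (beta mu nu : R) :
  beta < 1 -> admissible mu nu -> -2 < mu + nu ->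
  is_lim (fun x => lommel_int beta nu mu nu x / lommel_weight beta nu mu nu x)
    p_infty (/ (1 - beta)).
Proof.
intros Hbeta HA Hs.
destruct (lommel_int_primitive beta nu mu nu HA ltac:(lra)) as [HI _].
destruct (lommel_weight_dominates beta mu nu _ _ 1 0 Hbeta HA HI) as [K1 [X1 [HX1 H1]]].
{ intros x Hx; unfold Rdiv; lra. }
destruct (lommel_weight_dominates beta mu nu (fun x => - lommel_int beta nu mu nu x)
  (fun x => - lommel_weight beta nu mu nu x) (-1) 0 Hbeta HA) as [K2 [X2 [HX2 H2]]].
{ intros x Hx; apply (is_derive_opp (lommel_int beta nu mu nu) x), HI, Hx. }
{ intros x Hx; unfold Rdiv; lra. }
apply decays_is_lim; exists (Rmax K1 K2), (Rmax X1 X2); split.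
{ apply Rle_trans with (1 := HX1), Rmax_l. }
intros x Hx.
assert (HxX1 := Rle_trans _ _ _ (Rmax_l _ _) Hx).
assert (HxX2 := Rle_trans _ _ _ (Rmax_r _ _) Hx).
specialize (H1 x HxX1); specialize (H2 x HxX2).
assert (Hx0 : 0 <= / x) by (apply Rlt_le, Rinv_0_lt_compat; lra).
assert (H3 := Rmult_le_compat_r _ _ _ Hx0 (Rmax_l K1 K2)).
assert (H4 := Rmult_le_compat_r _ _ _ Hx0 (Rmax_r K1 K2)).
unfold Rdiv in *; apply Rabs_le; lra.
Qed.

Lemma lommel_B_negligible (beta mu nu : R) :
  0 < beta < 1 -> 0 < mu - nu + 1 -> 0 < mu + nu + 1 ->
  is_lim (fun x => lommel_B mu nu beta x / lommel_weight beta nu mu nu x) p_infty 0.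
Proof.
intros Hbeta Ha Hb.
assert (HA : admissible mu nu) by (unfold admissible; lra).
destruct (lommel_B_primitive beta mu nu) as [HB HB0]; [lra..|].
destruct (lommel_source_le mu nu HA) as [C [HC Hsrc]].
destruct (lommel_weight_dominates beta mu nu _ _ 0 C ltac:(lra) HA HB) as [K [X [HX HK]]].
{ intros x Hx; specialize (Hsrc x Hx).
  assert (He := exp_Rpower_pos beta nu x).
  unfold lommel_weight; apply (Rle_trans _ _ _ (Rle_abs _)) in Hsrc.
  apply (Rmult_le_compat_l (exp (- beta * x) * Rpower x nu)) in Hsrc; lra. }
apply decays_is_lim; exists K, X; split; [assumption|].
intros x Hx; specialize (HK x Hx).
assert (Hw := lommel_weight_pos beta nu mu nu x HA ltac:(lra)).
assert (HBx : 0 < lommel_B mu nu beta x).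
{ apply (pos_of_derive _ _ HB HB0); [|lra].
  intros u Hu; apply Rmult_lt_0_compat; [apply exp_Rpower_pos|apply lommel_source_pos; lra]. }
rewrite Rminus_0_r, Rabs_pos_eq by (apply Rdiv_nonneg; lra).
unfold Rdiv in *; lra.
Qed.

Lemma lommel_int_ratio_asymptotics (beta mu nu c : R) :
  0 < beta < 1 -> 0 < mu - nu + 1 -> 0 < mu + nu + 1 ->
  is_lim (fun x => lommel_int beta nu mu nu x /
    (1 / (1 - beta) *
      ((1 - c * (1 / x)) * lommel_weight beta nu mu nu x - lommel_B mu nu beta x))) p_infty 1.
Proof.
intros Hbeta Ha Hb.
assert (HA : admissible mu nu) by (unfold admissible; lra).
assert (HI := lommel_int_asymptotics beta mu nu ltac:(lra) HA ltac:(lra)).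
assert (HB := lommel_B_negligible beta mu nu Hbeta Ha Hb).
apply is_lim_ext_loc with (fun x =>
  (lommel_int beta nu mu nu x / lommel_weight beta nu mu nu x) /
  (/ (1 - beta) * ((1 - c * / x) - lommel_B mu nu beta x / lommel_weight beta nu mu nu x))).
{ exists 0; intros x Hx.
  assert (Hw := lommel_weight_pos beta nu mu nu x HA Hx).
  set (T := lommel_weight beta nu mu nu x) in *.
  replace (1 / (1 - beta) * ((1 - c * (1 / x)) * T - lommel_B mu nu beta x))
    with (T * (/ (1 - beta) * (1 - c * / x - lommel_B mu nu beta x / T))) by (field; lra).
  set (D := / (1 - beta) * _); unfold Rdiv; rewrite (Rinv_mult T D); ring. }
assert (Hden : is_lim (fun x =>
  / (1 - beta) * ((1 - c * / x) - lommel_B mu nu beta x / lommel_weight beta nu mu nu x))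
  p_infty (/ (1 - beta) * (1 - c * 0 - 0))).
{ apply (is_lim_scal_l _ (/ (1 - beta)) _ (Finite (1 - c * 0 - 0))).
  apply (is_lim_minus' _ _ _ (1 - c * 0) 0); [|exact HB].
  apply (is_lim_minus' _ _ _ 1 (c * 0)); [apply is_lim_const|].
  apply (is_lim_scal_l _ c _ (Finite 0)).
  apply (is_lim_inv (fun x => x) p_infty p_infty); [apply is_lim_id|discriminate]. }
assert (Hne : / (1 - beta) * (1 - c * 0 - 0) <> 0).
{ replace (1 - c * 0 - 0) with 1 by ring; rewrite Rmult_1_r.
  apply Rinv_neq_0_compat; lra. }
replace (Finite 1) with (Rbar_div (/ (1 - beta)) (/ (1 - beta) * (1 - c * 0 - 0))).
2:{ simpl; f_equal; field; lra. }
apply is_lim_div; [exact HI|exact Hden| |].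
- intros E; apply Hne; injection E; auto.
- exact I.
Qed.

Lemma lommel_t_add_asymptotics (mu nu : R) (k : nat) :
  admissible mu nu ->
  is_lim (fun x => lommel_t (mu + INR k) (nu + INR k) x / lommel_t mu nu x) p_infty 1.
Proof.
intros HA; induction k as [|k IH].
- apply is_lim_ext_loc with (fun _ => 1); [|apply is_lim_const].
  exists 0; intros x Hx; simpl INR; rewrite !Rplus_0_r.
  generalize (lommel_t_pos mu nu x HA Hx); intros; field; lra.
- assert (HAk := admissible_add _ _ k HA).
  apply is_lim_ext_loc with (fun x =>
    lommel_t (mu + INR k + 1) (nu + INR k + 1) x / lommel_t (mu + INR k) (nu + INR k) x
    * (lommel_t (mu + INR k) (nu + INR k) x / lommel_t mu nu x)).
  + exists 0; intros x Hx; rewrite S_INR, <- !Rplus_assoc.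
    assert (H1 := lommel_t_pos mu nu x HA Hx).
    assert (H2 := lommel_t_pos _ _ x HAk Hx).
    field; lra.
  + replace (Finite 1) with (Finite (1 * 1)) by (f_equal; ring).
    apply (is_lim_mult _ _ _ 1 1); [|exact IH|exact I].
    apply decays_is_lim, lommel_t_ratio_decays, HAk.
Qed.

Lemma partial_sum_asymptotics (beta mu nu : R) (N : nat) :
  admissible mu nu ->
  is_lim (fun x => sum_n (fun k =>
      beta ^ k * (lommel_t (mu + INR k + 1) (nu + INR k + 1) x / lommel_t mu nu x)) N)
    p_infty (sum_n (fun k => beta ^ k) N).
Proof.
intros HA.
assert (Hk : forall k, is_lim (fun x =>
  beta ^ k * (lommel_t (mu + INR k + 1) (nu + INR k + 1) x / lommel_t mu nu x))
  p_infty (beta ^ k)).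
{ intros k; replace (Finite (beta ^ k)) with (Rbar_mult (beta ^ k) 1)
    by (simpl; f_equal; ring).
  apply is_lim_scal_l.
  apply is_lim_ext with (2 := lommel_t_add_asymptotics mu nu (S k) HA).
  intros x; rewrite S_INR, <- !Rplus_assoc; reflexivity. }
induction N as [|N IH].
- rewrite sum_O; apply is_lim_ext with (2 := Hk 0%nat); intros x; rewrite sum_O; reflexivity.
- rewrite sum_Sn.
  apply is_lim_ext with (2 := is_lim_plus' _ _ _ _ _ IH (Hk (S N))).
  intros x; rewrite sum_Sn; reflexivity.
Qed.

Lemma sum_n_le_Series (c : nat -> R) (N : nat) :
  (forall k, 0 <= c k) -> ex_series c -> sum_n c N <= Series c.
Proof.
intros Hc Hex.
apply (is_lim_seq_incr_compare (sum_n c) (Series c) (Series_correct c Hex)).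
intros n; rewrite sum_Sn; change plus with Rplus; generalize (Hc (S n)); lra.
Qed.

(** Bounded above by the asymptotics of the integral, through [lommel_sum_lt];
    bounded below by a partial sum long enough to be within [eps / 2] of
    1 / (1 - beta). *)
Lemma lommel_sum_asymptotics (beta mu nu : R) :
  0 < beta < 1 -> admissible mu nu -> -2 < mu + nu ->
  is_lim (fun x => lommel_sum beta mu nu x / lommel_t mu nu x) p_infty (/ (1 - beta)).
Proof.
intros Hbeta HA Hs; apply is_lim_spec; intros eps.
assert (Heps := cond_pos eps).
assert (Hg : is_series (fun k => beta ^ k) (/ (1 - beta))).
{ apply is_series_geom; rewrite Rabs_pos_eq; lra. }
assert (He2 : 0 < eps / 2) by lra.
destruct (proj2 (is_lim_seq_spec (sum_n (fun k => beta ^ k)) (/ (1 - beta))) Hg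
  (mkposreal _ He2)) as [N HN].
specialize (HN N (Nat.le_refl N)); simpl in HN; apply Rabs_def2 in HN.
assert (HI := proj2 (is_lim_spec _ _ _)
  (lommel_int_asymptotics beta mu nu (proj2 Hbeta) HA Hs) eps).
assert (HS := proj2 (is_lim_spec _ _ _)
  (partial_sum_asymptotics beta mu nu N HA) (mkposreal _ He2)).
assert (H0 : Rbar_locally' p_infty (fun x => 0 < x)) by (exists 0; auto).
generalize (filter_and _ _ H0 (filter_and _ _ HI HS)); apply filter_imp.
intros x [Hx [HIx HSx]]; simpl in HIx, HSx.
apply Rabs_def2 in HIx; apply Rabs_def2 in HSx.
assert (Ht := lommel_t_pos mu nu x HA Hx).
assert (He := exp_Rpower_pos beta nu x).
destruct (lommel_sum_le beta mu nu x ltac:(lra) HA Hs Hx) as [Hex _].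
assert (Hup : lommel_sum beta mu nu x / lommel_t mu nu x
  <= lommel_int beta nu mu nu x / lommel_weight beta nu mu nu x).
{ assert (H := lommel_sum_lt beta mu nu x ltac:(lra) HA Hs Hx).
  assert (Hw := lommel_weight_pos beta nu mu nu x HA Hx).
  apply Rmult_le_reg_r with (1 := Hw); unfold Rdiv.
  rewrite (Rmult_assoc _ (/ _) (lommel_weight _ _ _ _ _)) at 1.
  replace (lommel_int beta nu mu nu x * / lommel_weight beta nu mu nu x
    * lommel_weight beta nu mu nu x) with (lommel_int beta nu mu nu x) by (field; lra).
  apply Rlt_le, Rle_lt_trans with (2 := H); right.
  unfold lommel_weight; field; lra. }
assert (Hlow : sum_n (fun k =>
    beta ^ k * (lommel_t (mu + INR k + 1) (nu + INR k + 1) x / lommel_t mu nu x)) N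
  <= lommel_sum beta mu nu x / lommel_t mu nu x).
{ unfold lommel_sum, Rdiv at 2; rewrite <- Series_scal_r.
  rewrite (Series_ext _ (fun k =>
    beta ^ k * (lommel_t (mu + INR k + 1) (nu + INR k + 1) x / lommel_t mu nu x)))
    by (intros; unfold Rdiv; ring).
  apply sum_n_le_Series.
  - intros k; apply Rmult_le_pos; [apply pow_le; lra|].
    apply Rdiv_nonneg; [|assumption].
    apply Rlt_le, lommel_t_pos; [apply admissible_succ, admissible_add, HA|assumption].
  - apply ex_series_ext with (2 := ex_series_scal_r (/ lommel_t mu nu x) _ Hex).
    intros k; unfold Rdiv; rewrite Rmult_assoc; reflexivity. }
apply Rabs_def1; lra.
Qed.

Lemma lommel_int_sum_asymptotics (beta mu nu : R) :
  0 < beta < 1 -> admissible mu nu -> -2 < mu + nu ->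
  is_lim (fun x => lommel_int beta nu mu nu x /
    (exp (- beta * x) * Rpower x nu * lommel_sum beta mu nu x)) p_infty 1.
Proof.
intros Hbeta HA Hs.
apply is_lim_ext_loc with (fun x =>
  (lommel_int beta nu mu nu x / lommel_weight beta nu mu nu x) /
  (lommel_sum beta mu nu x / lommel_t mu nu x)).
{ exists 0; intros x Hx.
  assert (Ht := lommel_t_pos mu nu x HA Hx).
  assert (He := exp_Rpower_pos beta nu x).
  unfold lommel_weight; set (e := exp (- beta * x) * Rpower x nu) in *.
  unfold Rdiv; rewrite !Rinv_mult, Rinv_inv.
  transitivity (lommel_int beta nu mu nu x * / e * / lommel_sum beta mu nu x
    * (/ lommel_t mu nu x * lommel_t mu nu x)); [ring|].
  rewrite Rinv_l by lra; ring. }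
replace (Finite 1) with (Rbar_div (/ (1 - beta)) (/ (1 - beta))).
2:{ simpl; f_equal; field; lra. }
assert (Hne : / (1 - beta) <> 0) by (apply Rinv_neq_0_compat; lra).
apply is_lim_div;
  [apply lommel_int_asymptotics; lra || assumption
  |apply lommel_sum_asymptotics; assumption| |].
- intros E; apply Hne; injection E; auto.
- exact I.
Qed.

(** Common shape of the three bounds that contain [lommel_B], with [c = 0] for
    [nu <= 0]. *)
Lemma lommel_int_gt_of_excess (beta mu nu c x : R) :
  beta < 1 -> 0 < x ->
  - (c / x * lommel_weight beta nu mu nu x) < lommel_excess beta mu nu x ->
  lommel_int beta nu mu nu x >
    1 / (1 - beta) *
      ((1 - c * (1 / x)) * lommel_weight beta nu mu nu x - lommel_B mu nu beta x).
Proof.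
intros Hbeta Hx H; unfold lommel_excess in H.
apply Rlt_gt, Rmult_lt_reg_l with (1 - beta); [lra|].
replace ((1 - beta) * (1 / (1 - beta) *
  ((1 - c * (1 / x)) * lommel_weight beta nu mu nu x - lommel_B mu nu beta x)))
  with (lommel_weight beta nu mu nu x - c / x * lommel_weight beta nu mu nu x
        - lommel_B mu nu beta x) by (field; lra).
lra.
Qed.

Theorem theorem2p3 (beta mu nu : R) (hbeta : 0 < beta < 1) :
  let I := fun x : R =>
    RInt_gen (fun u => exp (- beta * u) * Rpower u nu * lommel_t mu nu u)
             (at_right 0) (at_point x) in
  let T := fun x : R =>
    exp (- beta * x) * Rpower x nu * lommel_t mu nu x in
  let B := lommel_B mu nu beta in
  (-1 < mu -> - mu - 1 < nu <= 0 ->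
    let rhs := fun x : R => 1 / (1 - beta) * (T x - B x) in
    (forall x : R, 0 < x -> I x > rhs x) /\
    is_lim (fun x => I x / rhs x) p_infty 1)
  /\
  (1 / 2 < mu -> 3 / 2 <= nu < mu + 1 ->
    let rhs := fun x : R =>
      1 / (1 - beta) *
      ((1 - 4 * nu ^ 2 / ((2 * nu - 1) * (1 - beta)) * (1 / x)) * T x - B x) in
    (forall x : R, 0 < x -> I x > rhs x) /\
    is_lim (fun x => I x / rhs x) p_infty 1)
  /\
  (- (1 / 2) < mu -> 1 / 2 < nu < mu + 1 ->
    let rhs := fun x : R =>
      1 / (1 - beta) *
      ((1 - 2 * nu * (mu + nu + 1 / 2 * (5 + sqrt 17))
            / ((2 * nu - 1) * (1 - beta)) * (1 / x)) * T x - B x) in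
    (forall x : R, 0 < x -> I x > rhs x) /\
    is_lim (fun x => I x / rhs x) p_infty 1)
  /\
  (- (5 / 2) < mu -> - mu - 2 < nu <= mu + 3 ->
    let rhs := fun x : R =>
      exp (- beta * x) * Rpower x nu *
      Series (fun k : nat =>
        beta ^ k * lommel_t (mu + INR k + 1) (nu + INR k + 1) x) in
    (forall x : R, 0 < x -> I x > rhs x) /\
    is_lim (fun x => I x / rhs x) p_infty 1).
Proof.
intros I T B.
change I with (lommel_int beta nu mu nu).
change T with (lommel_weight beta nu mu nu).
unfold B; clear I T B.
split; [|split; [|split]]; intros Hmu Hnu; split.
- intros x Hx.
  replace (lommel_weight beta nu mu nu x)
    with ((1 - 0 * (1 / x)) * lommel_weight beta nu mu nu x) by ring.
  apply lommel_int_gt_of_excess; [lra|assumption|].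
  replace (- (0 / x * lommel_weight beta nu mu nu x)) with 0 by (field; lra).
  apply lommel_excess_pos; (assumption || lra).
- apply is_lim_ext with
    (2 := lommel_int_ratio_asymptotics beta mu nu 0 hbeta ltac:(lra) ltac:(lra)).
  intros x; rewrite Rmult_0_l, Rminus_0_r, Rmult_1_l; reflexivity.
- intros x Hx; apply lommel_int_gt_of_excess; [lra|assumption|].
  replace (4 * nu ^ 2 / ((2 * nu - 1) * (1 - beta)))
    with (2 * nu * (2 * nu / ((2 * nu - 1) * (1 - beta)))) by (field; lra).
  apply lommel_excess_gt; try lra.
  + apply Rmult_le_reg_r with (2 * nu - 1); [lra|]; field_simplify; lra.
  + field_simplify; lra.
- apply lommel_int_ratio_asymptotics; lra.
- intros x Hx; apply lommel_int_gt_of_excess; [lra|assumption|].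
  assert (Hs := sqrt_pos 17).
  set (D := mu + nu + 1 / 2 * (5 + sqrt 17)).
  assert (HD : 2 <= D /\ 2 * nu - 1 <= D) by (unfold D; lra).
  replace (2 * nu * D / ((2 * nu - 1) * (1 - beta)))
    with (2 * nu * (D / ((2 * nu - 1) * (1 - beta)))) by (field; lra).
  apply lommel_excess_gt; try lra.
  + apply Rmult_le_reg_r with (2 * nu - 1); [lra|]; field_simplify; lra.
  + field_simplify; lra.
- apply lommel_int_ratio_asymptotics; lra.
- intros x Hx; apply lommel_sum_lt; (assumption || unfold admissible; lra).
- apply lommel_int_sum_asymptotics; (assumption || unfold admissible; lra).
Qed.
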